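(* Let $r$ and $q$ be positive continuous functions on $\mathbb R$. Suppose that there exist numbers $a\ge 1$, $b>0$ and an interval $(\alpha,\beta)$ (with $\alpha<\beta$ real) such that for all $x\notin(\alpha,\beta)$ $$\frac1a\le \frac{r(t)}{r(x)}\le a\quad\text{and}\quad \frac1a\le\frac{q(t)}{q(x)}\le a\qquad\text{for all } t \text{ with } |t-x|\le b\,\frac{r(x)}{q(x)},$$ and that $$a^2\exp\Big(-\frac{b}{a^2}\Big)\le\frac13 .$$ Put $r_0=\inf_{x\in\mathbb R}r(x)$, $q_0=\inf_{x\in\mathbb R}q(x)$ and, for $p\in(1,\infty)$, $p'=\frac{p}{p-1}$, $\sigma_{p'}=\inf_{x\in\mathbb R}r(x)^{1/p}q(x)^{1/p'}$. Then the problem $$-r(x)y'(x)+q(x)y(x)=f(x),\quad x\in\mathbb R,\qquad \lim_{|x|\to\infty}y(x)=0$$ is (i) correctly solvable in $L_1(\mathbb R)$ if and only if $r_0>0$ and $q_0>0$; (ii) for $p\in(1,\infty)$, correctly solvable in $L_p(\mathbb R)$ if and only if $\sigma_{p'}>0$ and $q_0>0$; (iii) correctly solvable in $C(\mathbb R)$ (the case $p=\infty$) if and only if $q(x)\to\infty$ as $|x|\to\infty$.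
   Context: For $p\in[1,\infty)$, $L_p(\mathbb R)$ is the usual Lebesgue space with norm $\|\cdot\|_p$; for $p=\infty$ the convention is $L_\infty(\mathbb R):=C(\mathbb R)$, the space of bounded continuous functions on $\mathbb R$ with the supremum norm. A solution of the problem (for given $f\in L_p(\mathbb R)$) is any function $y$ on $\mathbb R$, absolutely continuous on every compact interval, that satisfies the differential equation almost everywhere on $\mathbb R$ and satisfies $y(x)\to0$ as $|x|\to\infty$. The problem is called correctly solvable in $L_p(\mathbb R)$ if (I) for every $f\in L_p(\mathbb R)$ there exists a unique solution $y\in L_p(\mathbb R)$, and (II) there is a constant $c_p\in(0,\infty)$, independent of $f$, such that $\|y\|_p\le c_p\|f\|_p$ for all $f\in L_p(\mathbb R)$. *)

(* Defs.v *)
From HB Require Import structures.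
From mathcomp Require Import all_boot all_order all_algebra.
From mathcomp Require Import all_classical all_reals all_analysis.
Set Implicit Arguments.
Unset Strict Implicit.
Unset Printing Implicit Defensive.
Import Order.TTheory GRing.Theory Num.Theory.
Import numFieldNormedType.Exports.
Local Open Scope classical_set_scope.
Local Open Scope ring_scope.

Section Definitions.
Context {R : realType}.
Implicit Types (f y r q : R -> R) (p : \bar R).

(* The [n] open intervals need not be listed in increasing order; empty ones
   ([u i = v i]) are harmless. *)
Definition abs_continuous_on (a b : R) y : Prop :=
  forall e : R, 0 < e -> exists2 d : R, 0 < d &
    forall (n : nat) (u v : 'I_n -> R),
      (forall i, [/\ a <= u i, u i <= v i & v i <= b]) ->
      trivIset [set: 'I_n] (fun i => `]u i, v i[%classic) ->
      \sum_(i < n) (v i - u i) < d ->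
      \sum_(i < n) `|y (v i) - y (u i)| < e.

(* Meant for [1 <= p <= +oo], with the convention that the space for [+oo]
   consists of the bounded continuous functions.  For [p] finite, elements are
   (Borel) representatives of the usual classes. *)
Definition Lp_space p : set (R -> R) :=
  if p == +oo%E then [set f | continuous f /\ bounded_fun f]
  else [set f | f \in Lfun (@lebesgue_measure R) p].

Definition Lp_norm p f : \bar R :=
  if p == +oo%E then ereal_sup [set (`|f x|)%:E | x in [set: R]]
  else Lnorm (@lebesgue_measure R) p (EFin \o f).

Definition is_solution r q f y : Prop :=
  [/\ forall a b : R, a <= b -> abs_continuous_on a b y,
      {ae @lebesgue_measure R, forall x : R,
         derivable y x 1 /\ - r x * derive1 y x + q x * y x = f x},
      y x @[x --> +oo] --> (0 : R) &
      y x @[x --> -oo] --> (0 : R)].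

Definition correctly_solvable p r q : Prop :=
  (forall f, Lp_space p f ->
     exists! y, Lp_space p y /\ is_solution r q f y) /\
  (exists2 c : R, 0 < c &
     forall f y, Lp_space p f -> Lp_space p y -> is_solution r q f y ->
       (Lp_norm p y <= c%:E * Lp_norm p f)%E).

End Definitions.

(* Main.v *)
Require Import Defs.
From HB Require Import structures.
From mathcomp Require Import all_boot all_order all_algebra.
From mathcomp Require Import all_classical all_reals all_analysis.
From mathcomp Require Import measurable_realfun ring lra.
Import Order.TTheory GRing.Theory Num.Theory.
Import numFieldNormedType.Exports.
Local Open Scope classical_set_scope.
Local Open Scope ring_scope.

(** Let Phi be a primitive of q / r and write decay = exp (- Phi).  Multiplying
by decay turns the equation into (y decay)' = - decay f / r almost everywhere,
so a solution with y decay -> 0 at +oo must be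

  sol f x = exp (Phi x) * \int_x^oo decay f / r.

Solutions that vanish at +oo have this property, and the homogeneous solution
exp Phi does not: uniqueness costs nothing and everything is a question about
the single operator sol ([correctly_solvable_sol]).

Absolute continuity enters through one fact, [abs_continuous_nonincreasing]: an
absolutely continuous function whose derivative is nonpositive almost
everywhere is nonincreasing.  It gives a comparison principle for the equation
([ode_ge0]), which replaces most estimates of integrals: since the constant L
solves the equation with right-hand side L q, a bound |f| <= L q + g yields
|sol f| <= L + sol g ([sol_dominated]).

Slow variation of r and q at scale width = r / q has three consequences outside
the interval ]alpha, beta[.  Over a window of length b width x, Phi grows by at
least b / a^2, hence Phi tends to -oo at -oo ([Phi_unbounded]); it grows by at
most b a^2, hence a nonnegative f that is at least c on the window forces
y >= c kappa / q x on its left half ([ode_window_lower]); and, stepping back by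
one window, the smallness of a^2 exp (- b / a^2) gives, for every t,
\int_{-oo}^t exp (Phi x - Phi t) dx <= C r t / q t ([expPhi_integral_le]).

Sufficiency for finite p.  With g = |f|^p / q^(p-1), the elementary inequality
|f| <= l q + g / l^(p-1) and the comparison principle give
|sol f|^p <= 2^p sol g.  The kernel of sol g is exp (Phi x - Phi t) for x <= t,
at most 1, applied to g / r = |f|^p / weight^p, where
weight = r^(1/p) q^(1-1/p): if weight is bounded away from 0 this function is
integrable and dominated convergence makes sol g vanish at both ends.  Tonelli's
theorem and the bound on the integral of exp (Phi x - Phi t) in x give
\int sol g <= C \int |f|^p / q^p, which is the norm estimate.

Necessity for finite p.  Testing the norm estimate on the indicator of a window
at x bounds q x from below.  If weight had infimum 0, one could pick points x_n
going to infinity with weight^p summable along them; bumps of height q x_n over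
the windows at x_n then add up to a function of finite p-norm
([bump_series]), whose solution stays above kappa at every x_n.

For p = +oo, |f| <= (M / q) q gives |sol f| <= sup (M / q) on rays to the right,
and an initial-value version of it on rays to the left; conversely the solution
for f = 1 is at least kappa / q, so q must tend to +oo with 1 / y. *)

(** * Absolutely continuous functions *)

Section AbsoluteContinuity.
Set Implicit Arguments.
Unset Strict Implicit.
Context {R : realType}.
Notation mu := (@lebesgue_measure R).
Implicit Types (U : set R) (s t u x y a b : R) (z f g : R -> R).

Lemma aeS (P Q : R -> Prop) : {ae mu, forall x, P x} ->
  (forall x, P x -> Q x) -> {ae mu, forall x, Q x}.
Proof.
by move=> aP PQ; apply: (@filterS _ _ (ae_filter_ringOfSetsType mu) _ _ PQ).
Qed.

Lemma aeS2 (P1 P2 Q : R -> Prop) : {ae mu, forall x, P1 x} ->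
  {ae mu, forall x, P2 x} -> (forall x, P1 x -> P2 x -> Q x) ->
  {ae mu, forall x, Q x}.
Proof.
by move=> a1 a2 PQ; apply: (@filterS2 _ _ (ae_filter_ringOfSetsType mu) _ _ _ PQ).
Qed.

(** The supremum of the [t] with [P a t] is [b], because a pair of points
around this supremum extends [P] past it.  In this form the covering lemma
spares the construction of a tagged partition. *)
Lemma cousin (P : R -> R -> Prop) a b : a <= b ->
  (forall s t u, s <= t -> t <= u -> P s t -> P t u -> P s u) ->
  (forall x, a <= x <= b -> exists2 d : R, 0 < d &
     forall s t, a <= s -> t <= b -> s <= x <= t -> x - d < s -> t < x + d ->
       P s t) ->
  P a b.
Proof.
move=> ab Padd Ploc.
pose S := [set t | a <= t <= b /\ P a t].
have Sa : S a.
  split; first by rewrite lexx.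
  have [|d d0] := Ploc a; first by rewrite lexx ab.
  by apply; rewrite ?lexx//; lra.
have ubS : ubound S b by move=> t [/andP[]].
have hS : has_sup S by split; [exists a|exists b].
have ac : a <= sup S by apply: sup_upper_bound.
have cb : sup S <= b by apply: ge_sup => //; exists a.
have [|d d0 Pd] := Ploc (sup S); first by rewrite ac cb.
have [t St ct] := sup_adherent d0 hS.
have tc : t <= sup S by apply: sup_upper_bound.
case: St => /andP[at_ tb] Pt.
(* a point just beyond sup S, or b itself *)
have cm : sup S <= Num.min b (sup S + d / 2) by rewrite le_min cb/=; lra.
have Pv : P t (Num.min b (sup S + d / 2)).
  apply: Pd => //; rewrite ?tc//.
    by rewrite ge_min lexx.
  by rewrite gt_min; apply/orP; right; lra.
have Sv : S (Num.min b (sup S + d / 2)).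
  split; first by rewrite ge_min lexx/= andbT (le_trans ac).
  by apply: Padd Pt Pv => //; exact: le_trans cm.
have /(_ _ Sv) := sup_upper_bound hS.
rewrite ge_min => /orP[bc|]; last by lra.
by case: Sv => _; rewrite min_l//; lra.
Qed.

(** Lists in increasing order make the concatenation of two adjacent
packings a packing, at the cost of a translation to indexed families. *)
Definition packing U a b (l : seq (R * R)) :=
  (forall i, i \in l ->
     [/\ a <= i.1, i.1 <= i.2, i.2 <= b & `[i.1, i.2] `<=` U]) /\
  pairwise (fun i j => i.2 <= j.1) l.

Definition oscillation z (l : seq (R * R)) := \sum_(i <- l) `|z i.2 - z i.1|.

Lemma packing_cat U s t u l1 l2 : s <= t -> t <= u ->
  packing U s t l1 -> packing U t u l2 -> packing U s u (l1 ++ l2).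
Proof.
move=> st tu [h1 p1] [h2 p2]; split.
  move=> i; rewrite mem_cat => /orP[/h1|/h2] [? ? ? ?]; split => //; lra.
rewrite pairwise_cat p1 p2 !andbT; apply/allrelP => i j /h1[_ _ + _] /h2[+ _ _ _].
exact: le_trans.
Qed.

(** Non-overlapping segments inside [U] have total length at most the
measure of [U]. *)
Lemma abs_continuous_on_packing a b z (e : R) :
  abs_continuous_on a b z -> 0 < e -> exists2 d : R, 0 < d &
    (forall U l, open U -> (mu U < d%:E)%E -> packing U a b l ->
      oscillation z l < e).
Proof.
move=> acz e0; have [d d0 acd] := acz e e0; exists d => // U l oU Ud [hl pl].
have hn (i : 'I_(size l)) := hl _ (mem_nth (0, 0) (ltn_ord i)).
rewrite /oscillation (big_nth (0, 0)) big_mkord.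
have tI : trivIset [set: 'I_(size l)]
    (fun i => `](nth (0, 0) l i).1, (nth (0, 0) l i).2[%classic).
  apply/trivIsetP => i j _ _ ij.
  wlog lij : i j ij / (i < j)%N => [hw|].
    have := ij; rewrite -(inj_eq val_inj) neq_ltn => /orP[|] lij; first exact: hw.
    by rewrite setIC; apply: hw => //; rewrite eq_sym.
  have /(pairwiseP (0, 0))/(_ i j) := pl.
  rewrite !inE !ltn_ord => /(_ isT isT lij) ltij.
  rewrite -subset0 => x /= []; rewrite !in_itv/= => /andP[_ h1] /andP[h2 _].
  by have := lt_trans h2 h1; rewrite ltNge ltij.
apply: acd => //.
- by move=> i; have [? ? ? _] := hn i; split.
- rewrite -lte_fin; apply: le_lt_trans Ud.
  rewrite -sumEFin.
  pose I (i : 'I_(size l)) := `](nth (0, 0) l i).1, (nth (0, 0) l i).2[%classic.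
  rewrite (eq_bigr (fun i => mu (I i))); last first.
    move=> i _; rewrite lebesgue_measure_itv/= lte_fin.
    have [_ + _ _] := hn i; rewrite le_eqVlt => /orP[/eqP ->|->//].
    by rewrite ltxx subrr.
  have mI : measurable (\big[setU/set0]_(i < size l) I i).
    by apply: bigsetU_measurable => i _; exact: measurable_itv.
  rewrite -measure_semi_additive_ord//=; last by move=> k; exact: measurable_itv.
  apply: le_measure; rewrite ?inE//=; [exact: open_measurable|].
  apply: (big_ind (fun X => X `<=` U)) => // [X Y XU YU x []|i _ x];
    [exact: XU|exact: YU|].
  by have [_ _ _ + /subset_itv_oo_cc] := hn i; exact.
Qed.

(** The points [s] and [t] lie on both sides of [x], so the two difference
quotients at [x] combine without any uniformity. *)
Lemma derive_le0_slope z x (e : R) : 0 < e ->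
  derivable z x 1 -> derive1 z x <= 0 -> exists2 d : R, 0 < d &
    forall s t, s <= x <= t -> x - d < s -> t < x + d ->
      z t - z s <= e * (t - s).
Proof.
move=> e0 dz z0; rewrite derive1E in z0.
have : (h^-1 *: ((z \o shift x) (h *: 1) - z x)) @[h --> 0^'] --> 'D_1 z x by [].
move=> /cvgr_lt /(_ e); rewrite (le_lt_trans z0 e0) => /(_ isT).
rewrite near_withinE => -[d /= d0 hd]; exists d => // s t /andP[sx xt] ds dt.
have key h : `|h| < d -> h != 0 -> (z (h + x) - z x) / h < e.
  move=> hlt h0; have := hd h; rewrite /ball/= sub0r normrN => /(_ hlt h0).
  by rewrite /GRing.scale/= mulr1 mulrC.
have h1 : z t - z x <= e * (t - x).
  move: xt; rewrite le_eqVlt => /orP[/eqP ->|xt]; first by rewrite !subrr mulr0.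
  have := key (t - x); rewrite subrK ltr_pdivrMr ?subr_gt0// => H.
  by apply/ltW/H; [rewrite gtr0_norm; lra | lra].
have h2 : z x - z s <= e * (x - s).
  move: sx; rewrite le_eqVlt => /orP[/eqP ->|sx]; first by rewrite !subrr mulr0.
  have := key (s - x); rewrite subrK ltr_ndivrMr ?subr_lt0// => H.
  have : e * (s - x) < z s - z x by apply: H; [rewrite ltr0_norm; lra|lra].
  lra.
lra.
Qed.

(** Cover the exceptional null set by an open set [U] on which [z] can vary by
at most [e / 2].  Near a point of [U] the variation of [z] is charged to a
segment in [U]; near any other point the increments of [z] are at most
[e1 * (t - s)].  Both charges are additive, so [cousin] carries them to
[a, b]. *)
Lemma abs_continuous_nonincreasing a b z : a <= b -> abs_continuous_on a b z ->
  {ae mu, forall x, a <= x <= b -> derivable z x 1 /\ derive1 z x <= 0} ->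
  z b <= z a.
Proof.
move=> ab acz /negligible_outer_measure; set N := ~` _ => N0.
apply/ler_addgt0Pr => e e0.
have e20 : 0 < e / 2 by rewrite divr_gt0.
pose e1 := e / 2 / (b - a + 1).
have e10 : 0 < e1 by rewrite divr_gt0//; lra.
have [d d0 dosc] := abs_continuous_on_packing acz e20.
(* the exceptional set sits in an open set too small for z to vary on *)
have [U [oU NU muU]] : exists U, [/\ open U, N `<=` U & (mu U < d%:E)%E].
  have d20 : 0 < d / 2 by rewrite divr_gt0.
  have [U [oU NU muU]] := outer_measure_open_le N d20.
  exists U; split => //; apply: le_lt_trans muU _.
  by rewrite N0 add0e lte_fin; lra.
pose P s t := exists2 l, packing U s t l &
  z t - z s <= e1 * (t - s) + oscillation z l.
have [l pl Hl] : P a b.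
  apply: cousin => //.
  - move=> s t u st tu [l1 p1 h1] [l2 p2 h2]; exists (l1 ++ l2).
      exact: packing_cat p1 p2.
    rewrite /oscillation big_cat/= -!/(oscillation _ _); lra.
  - move=> x xab; have [Ux|nUx] := pselect (U x).
      have /nbhs_ballP[d1 /= d10 hd1] : nbhs x U by exact: open_nbhs_nbhs.
      exists d1 => // s t as_ tb /andP[sx xt] ds dt; exists [:: (s, t)].
        split=> // i; rewrite inE => /eqP -> /=; split => //; first exact: le_trans xt.
        move=> y /=; rewrite in_itv/= => /andP[sy yt]; apply: hd1.
        by rewrite /ball/= ltr_distlC; apply/andP; split; lra.
      rewrite /oscillation big_seq1/=.
      have := ler_norm (z t - z s).
      have : 0 <= e1 * (t - s) by rewrite mulr_ge0//; lra.
      lra.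
    have [dz z0] : derivable z x 1 /\ derive1 z x <= 0.
      by apply: contrapT => nz; apply/nUx/NU => /(_ xab).
    have [d1 d10 hd1] := derive_le0_slope e10 dz z0.
    exists d1 => // s t as_ tb sxt ds dt; exists [::]; first by split.
    by rewrite /oscillation big_nil addr0; exact: hd1.
have := dosc _ _ oU muU pl.
have : e1 * (b - a) <= e / 2.
  rewrite /e1 mulrAC -mulrA ler_piMr ?(ltW e20)//.
  by rewrite ler_pdivrMr; lra.
lra.
Qed.

Lemma abs_continuous_on_id a b : abs_continuous_on a b id.
Proof.
move=> e e0; exists e => // n u v uv _; apply: le_lt_trans; apply: ler_sum => i _.
by have [_ h _] := uv i; rewrite ger0_norm ?subr_ge0.
Qed.

(** Sums, products, Lipschitz functions and changes of sign are all instances. *)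
Lemma abs_continuous_on_dominated a b f g z (M : R) :
  abs_continuous_on a b f -> abs_continuous_on a b g ->
  (forall u v, a <= u -> u <= v -> v <= b ->
    `|z v - z u| <= M * (`|f v - f u| + `|g v - g u|)) ->
  abs_continuous_on a b z.
Proof.
move=> acf acg zfg e e0.
have M1 : 0 < `|M| + 1 by rewrite ltr_wpDl.
have eM : 0 < e / (`|M| + 1) / 2 by rewrite !divr_gt0.
have [d1 d10 hf] := acf _ eM; have [d2 d20 hg] := acg _ eM.
exists (Num.min d1 d2); first by rewrite lt_min d10.
move=> n u v uv tuv; rewrite lt_min => /andP[/(hf _ _ _ uv tuv) Hf /(hg _ _ _ uv tuv) Hg].
have := ltrD Hf Hg; rewrite -splitr -big_split/= ltr_pdivlMr// mulrC => H.
apply: le_lt_trans H; rewrite mulr_sumr; apply: ler_sum => i _.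
have [au uvi vb] := uv i; apply: (le_trans (zfg _ _ au uvi vb)).
by rewrite ler_wpM2r ?addr_ge0// (le_trans (ler_norm _))// lerDl.
Qed.

Definition locally_ac z := forall a b, a <= b -> abs_continuous_on a b z.

Lemma locally_ac_continuous z : locally_ac z -> continuous z.
Proof.
move=> acz x; apply/cvgrPdist_lt => e e0.
have [|d d0 hd] := acz (x - 1) (x + 1) _ e e0; first lra.
near=> t.
pose u (i : 'I_1) := Num.min x t; pose v (i : 'I_1) := Num.max x t.
have xt : `|x - t| < Num.min d 1.
  by near: t; apply: cvgr_dist_lt; [exact: cvg_id|rewrite lt_min d0 ltr01].
have := hd 1%N u v; rewrite !big_ord1 /u /v.
have -> : `|z (Num.max x t) - z (Num.min x t)| = `|z x - z t|.
  by case: (leP x t) => // _; rewrite distrC.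
have -> : Num.max x t - Num.min x t = `|x - t|.
  by case: (leP x t) => h; [rewrite ler0_norm; lra|rewrite gtr0_norm; lra].
apply.
- move=> _; move: xt; rewrite lt_min ltr_norml => /andP[_]; rewrite ltr_norml.
  by case: (leP x t) => h /andP[? ?]; split; lra.
- by apply/trivIsetP => i j _ _; rewrite !ord1 eqxx.
- by move: xt; rewrite lt_min => /andP[].
Unshelve. all: by end_near. Qed.

Lemma continuous_bounded_itv f a b : continuous f -> a <= b ->
  exists2 M : R, 0 < M & forall x, a <= x <= b -> `|f x| <= M.
Proof.
move=> cf ab; have [|c _ hc] := @EVT_max R (fun x => `|f x|) a b ab.
  apply: continuous_subspaceT => x; apply: continuous_comp; first exact: cf.
  exact: norm_continuous.
exists (`|f c| + 1); first by rewrite ltr_wpDl.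
by move=> x xab; apply: (le_trans (hc x _)); rewrite ?in_itv// lerDl.
Qed.

Lemma locally_acD f g : locally_ac f -> locally_ac g -> locally_ac (f \+ g).
Proof.
move=> acf acg a b ab; apply: (@abs_continuous_on_dominated _ _ f g _ 1).
- exact: acf.
- exact: acg.
move=> u v _ _ _ /=; rewrite mul1r.
by rewrite (_ : _ - _ = (f v - f u) + (g v - g u)) ?ler_normD//; ring.
Qed.

Lemma locally_acM f g : locally_ac f -> locally_ac g -> locally_ac (f \* g).
Proof.
move=> acf acg a b ab.
have [M M0 fM] := continuous_bounded_itv (locally_ac_continuous acf) ab.
have [N N0 gN] := continuous_bounded_itv (locally_ac_continuous acg) ab.
apply: (@abs_continuous_on_dominated _ _ f g _ (M + N)).
- exact: acf.
- exact: acg.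
move=> u v au uv vb /=.
rewrite (_ : _ - _ = g u * (f v - f u) + f v * (g v - g u)); last ring.
apply: (le_trans (ler_normD _ _)); rewrite !normrM mulrDr; apply: lerD.
  rewrite ler_wpM2r// (le_trans (gN u _)) ?lerDr ?(ltW M0)//.
  by rewrite au (le_trans uv).
rewrite ler_wpM2r// (le_trans (fM v _)) ?lerDl ?(ltW N0)//.
by rewrite vb (le_trans au).
Qed.

Lemma continuous_derive_locally_ac F f :
  (forall x, is_derive x 1 F (f x)) -> continuous f -> locally_ac F.
Proof.
move=> dF cf a b ab; have [M M0 fM] := continuous_bounded_itv cf ab.
apply: (@abs_continuous_on_dominated _ _ id id _ M).
- exact: abs_continuous_on_id.
- exact: abs_continuous_on_id.
move=> u v au uv vb.
apply: (@le_trans _ _ (M * `|v - u|)); last first.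
  by rewrite ler_pM2l// lerDl.
move: uv; rewrite le_eqVlt => /orP[/eqP ->|uv]; first by rewrite !subrr normr0 mulr0.
have [|c] := @MVT R F f u v uv (fun x _ => dF x).
  apply: derivable_within_continuous => x _; exact: ex_derive.
rewrite in_itv/= => /andP[uc cv] ->; rewrite normrM ler_wpM2r//.
by apply: fM; apply/andP; split; lra.
Qed.

(** * Primitives of locally integrable functions *)

(** Stated by increments, so that minus the integral over a right ray
qualifies as well as an integral from a base point. *)
Definition primitive F f :=
  forall u v, u <= v -> F v - F u = \int[mu]_(t in `[u, v]) f t.

Lemma locally_integrable_itv f a b :
  locally_integrable [set: R] f -> mu.-integrable `[a, b] (EFin \o f).
Proof.
move=> [mf _ hf]; apply/integrableP; split.
  by apply/measurable_EFinP; exact: measurable_funS mf.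
by apply: hf => //; exact: segment_compact.
Qed.

(** Absolute continuity of the Lebesgue integral of [f], restricted to [a, b],
over the union of the intervals. *)
Lemma primitive_locally_ac F f :
  locally_integrable [set: R] f -> primitive F f -> locally_ac F.
Proof.
move=> lf Ff a b ab e e0; pose g := f \_ `[a, b].
have fab := locally_integrable_itv a b lf.
have intg : mu.-integrable setT (EFin \o g).
  by rewrite /g -restrict_EFin; apply/integrable_restrict => //=; rewrite setTI.
have mg : measurable_fun setT g.
  by apply/measurable_EFinP; exact: measurable_int intg.
have [d [d0 hd]] := integral_normr_continuous intg e0.
exists d => // n u v uv tuv sd.
pose I i := `]u i, v i[%classic.
pose A := \big[setU/set0]_(i < n) I i.
have mI i : measurable (I i) by exact: measurable_itv.
have mA : measurable A by exact: bigsetU_measurable.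
have muA : (mu A < d%:E)%E.
  rewrite measure_semi_additive_ord//;
  apply: (@le_lt_trans _ _ (\sum_(i < n) (v i - u i))%:E); last by rewrite lte_fin.
  rewrite -sumEFin; apply: lee_sum => i _.
  rewrite -[leLHS]/(mu (I i)) lebesgue_measure_itv/=.
  by case: ifPn => _ //; rewrite lee_fin subr_ge0; case: (uv i).
apply: le_lt_trans (hd A mA muA).
rewrite -lee_fin -sumEFin.
rewrite /Rintegral fineK; last first.
  apply: integrable_fin_num => //.
  have /integrable_abse := intg; exact: integrableS.
rewrite ge0_integral_bigsetU//=.
- apply: lee_sum => i _; have [aui uvi vib] := uv i.
  have fi := locally_integrable_itv (u i) (v i) lf.
  rewrite Ff// EFin_normr_Rintegral//=.
  apply: (le_trans (le_abse_integral _ _ _)) => //=.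
    exact: measurable_int fi.
  rewrite integral_itv_bndoo; last first.
    apply/measurable_EFinP/measurableT_comp => //.
    by case: lf => mf _ _; exact: measurable_funS mf.
  rewrite le_eqVlt; apply/orP; left; apply/eqP.
  apply: eq_integral => x; rewrite inE/= in_itv/= => /andP[ux xv].
  by rewrite /g patchE mem_set//= in_itv/=; apply/andP; split; lra.
- exact: index_enum_uniq.
- exact: sub_trivIset tuv.
- by apply/measurable_EFinP/measurableT_comp => //; exact: measurable_funS mg.
Qed.

(** Near [x] the function [F] differs from [G] by the constant [F a]. *)
Lemma primitive_derive_at F f a x (G := fun y => \int[mu]_(t in `[a, y]) f t) :
  primitive F f -> a < x ->
  derivable G x 1 /\ derive1 G x = f x -> is_derive x 1 F (f x).
Proof.
move=> Ff ax [dG G']; rewrite derive1E in G'.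
have near_FG : {near x, G + cst (F a) =1 F}.
  near=> y; rewrite /G/= -[LHS]/(\int[mu]_(t in `[a, y]) f t + F a) -Ff ?subrK//.
  by rewrite ltW// -ltrN2; near: y; apply: Nlt_nbhsl; rewrite ltrN2.
have dGc : is_derive x 1 (G + cst (F a)) (f x).
  rewrite -[f x]addr0; apply: is_deriveD.
  by split.
split; first by apply: near_eq_derivable near_FG _; exact: ex_derive.
by rewrite -(near_eq_derive _ near_FG) derive_val.
Unshelve. all: by end_near. Qed.

(** Lebesgue differentiation from the base points [- n], for all [n] at once. *)
Lemma primitive_ae_derive F f : locally_integrable [set: R] f ->
  primitive F f -> {ae mu, forall x, is_derive x 1 F (f x)}.
Proof.
move=> lf Ff.
have := @ae_foralln _ _ R mu _ (fun n =>
  @FTC1 R f (BLeft (- n%:R)) (fun y => locally_integrable_itv _ y lf) lf).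
apply: filterS => x hx.
have nx : - (Num.trunc (- x : R)).+1%:R < (x : R) by rewrite ltrNl truncnS_gt.
apply: (primitive_derive_at Ff nx); apply: (hx (Num.trunc (- x)).+1).
by rewrite lte_fin.
Qed.

Lemma primitive_continuous_derive F f :
  continuous f -> locally_integrable [set: R] f ->
  primitive F f -> forall x, is_derive x 1 F (f x).
Proof.
move=> cf lf Ff x.
have lx : x - 1 < x by lra.
apply: (primitive_derive_at Ff lx).
apply: (@continuous_FTC1_closed _ f (x - 1) x (x + 1)) => //; first lra.
  exact: locally_integrable_itv.
exact: cf.
Qed.

Lemma continuous_locally_integrable f :
  continuous f -> locally_integrable [set: R] f.
Proof.
move=> cf; split; [exact: continuous_measurable_fun|exact: openT|].
move=> K _ cK; have /integrableP[] // : mu.-integrable K (EFin \o f).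
by apply: continuous_compact_integrable => //; exact: continuous_subspaceT.
Qed.

Lemma continuous_antiderivative f : continuous f ->
  exists F, forall x, is_derive x 1 F (f x).
Proof.
move=> cf; have lf := continuous_locally_integrable cf.
pose I u v := \int[mu]_(t in `[u, v]) f t.
have Iadd u v w : u <= v -> v <= w -> I u w = I u v + I v w.
  move=> uv vw.
  have := @Rintegral_itvB R f (BLeft u) (BRight w) v (locally_integrable_itv _ _ lf).
  move=> /(_ uv vw); rewrite Rintegral_itv_obnd_cbnd -/(I u w) -/(I u v) -/(I v w).
    by move=> <-; rewrite addrC subrK.
  apply: integrableS (locally_integrable_itv v w lf) => //.
  exact: subset_itv_oc_cc.
exists (fun x => if 0 <= x then I 0 x else - I x 0).
apply: primitive_continuous_derive => // u v uv; rewrite -/(I u v).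
case: (leP 0 v) => v0; case: (leP 0 u) => u0.
- by rewrite (Iadd 0 u v)//; ring.
- by rewrite (Iadd u 0 v)//; [ring|exact: ltW].
- lra.
- by rewrite (Iadd u v 0)//; [ring|exact: ltW].
Qed.

End AbsoluteContinuity.

(** * Auxiliary facts of real analysis *)

Section RealAnalysis.
Set Implicit Arguments.
Unset Strict Implicit.
Context {R : realType}.
Notation mu := (@lebesgue_measure R).
Implicit Types (f g h F : R -> R) (x t c k A : R).

Lemma continuous_div f g : continuous f -> continuous g -> (forall x, g x != 0) ->
  continuous (fun x => f x / g x).
Proof.
by move=> cf cg g0 x; apply: cvgM; [exact: cf|apply: cvgV; [exact: g0|exact: cg]].
Qed.

Lemma continuous_itv_lower f (a b : R) : continuous f -> (forall x, 0 < f x) ->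
  exists2 m : R, 0 < m & forall x, a <= x <= b -> m <= f x.
Proof.
move=> cf f0; case: (leP a b) => ab; last first.
  by exists 1 => // x /andP[ax xb]; have := le_trans ax xb; rewrite leNgt ab.
have [c _ hc] := @EVT_min R f a b ab (continuous_subspaceT cf).
by exists (f c) => // x xab; apply: hc; rewrite in_itv.
Qed.

Lemma derive_lower F f k (u v : R) : (forall x : R, is_derive x 1 F (f x)) -> u <= v ->
  (forall x, u <= x <= v -> k <= f x) -> k * (v - u) <= F v - F u.
Proof.
move=> dF; rewrite le_eqVlt => /orP[/eqP ->|uv] kf; first by rewrite !subrr mulr0.
have [|c] := @MVT R F f u v uv (fun x _ => dF x).
  by apply: derivable_within_continuous => x _; case: (dF x).
rewrite in_itv/= => /andP[uc cv] ->; rewrite ler_pM2r ?subr_gt0//.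
by apply: kf; rewrite !ltW.
Qed.

Lemma derive_upper F f k (u v : R) : (forall x : R, is_derive x 1 F (f x)) -> u <= v ->
  (forall x, u <= x <= v -> f x <= k) -> F v - F u <= k * (v - u).
Proof.
move=> dF uv kf; have dN x : is_derive x 1 (fun x => - F x) (- f x) by exact: is_deriveN.
have := @derive_lower (fun x => - F x) (fun x => - f x) (- k) u v dN uv.
have H x : u <= x <= v -> - k <= - f x by rewrite lerN2; exact: kf.
by move=> /(_ H); lra.
Qed.

Lemma bounded_fun_bound f :
  bounded_fun f -> exists2 M : R, 0 < M & forall x, `|f x| <= M.
Proof.
move=> [M [_ hM]]; exists (`|M| + 1); first by rewrite ltr_wpDl.
by move=> x; apply: hM => //; rewrite (le_lt_trans (ler_norm M)) ?ltrDl.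
Qed.

Lemma bound_bounded_fun f (M : R) : (forall x, `|f x| <= M) -> bounded_fun f.
Proof.
move=> fM; exists M; split; first exact: num_real.
by move=> N MN x _; apply: le_trans (ltW MN).
Qed.

Lemma near_pinfty_ray (P : R -> Prop) : (\forall x \near +oo, P x) ->
  exists A : R, forall x, A <= x -> P x.
Proof. by move=> [M [_ hM]]; exists (M + 1) => x Mx; apply: hM; lra. Qed.

Lemma near_ninfty_ray (P : R -> Prop) : (\forall x \near -oo, P x) ->
  exists A : R, forall x, x <= A -> P x.
Proof. by move=> [M [_ hM]]; exists (M - 1) => x Mx; apply: hM; lra. Qed.

Lemma inf_gt0P (T : Type) (g : T -> R) (x0 : T) :
  (forall x : T, 0 <= g x) ->
  0 < inf (range g) <-> exists2 k : R, 0 < k & forall x : T, k <= g x.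
Proof.
move=> g0; split=> [ginf|[k k0 kg]].
  exists (inf (range g)) => // x; apply: ge_inf; last by exists x.
  by exists 0 => _ [t _ <-].
apply: (lt_le_trans k0); apply: lb_le_inf; first by exists (g x0), x0.
by move=> _ [t _ <-].
Qed.

Lemma ge0_integral_itv F f (u v : R) : continuous f -> (forall x, 0 <= f x) ->
  (forall x : R, is_derive x 1 F (f x)) -> u <= v ->
  (\int[mu]_(x in `[u, v]) (f x)%:E = (F v - F u)%:E)%E.
Proof.
move=> cf f0 dF; rewrite le_eqVlt => /orP[/eqP ->|uv].
  by rewrite subrr set_itv1 integral_set1.
have Fc : continuous F.
  by move=> x; apply/differentiable_continuous/derivable1_diffP; case: (dF x).
rewrite (@continuous_FTC2 R f F)//.
- exact: continuous_subspaceT.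
- split; first by move=> x _; case: (dF x).
  + exact/cvg_at_right_filter/Fc.
  + exact/cvg_at_left_filter/Fc.
- by move=> x _; rewrite derive1E; case: (dF x).
Qed.

Lemma integral_bigcup_le (D : (set R)^nat) f (M : \bar R) : measurable_fun setT f ->
  (forall x, 0 <= f x) -> {homo D : n m / (n <= m)%N >-> (n <= m)%O} ->
  (forall n, measurable (D n)) ->
  (forall n, (\int[mu]_(x in D n) (f x)%:E <= M)%E) ->
  (\int[mu]_(x in \bigcup_n D n) (f x)%:E <= M)%E.
Proof.
move=> mf f0 ndD mD leM.
have H : (\int[mu]_(x in D i) (f x)%:E)%E @[i --> \oo] -->
    (\int[mu]_(x in \bigcup_i D i) (f x)%:E)%E.
  apply: ge0_nondecreasing_set_cvg_integral => // [i|i x _]; last by rewrite lee_fin.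
  by apply/measurable_EFinP; exact: measurable_funS mf.
rewrite -(cvg_lim _ H)//; apply: lime_le; last exact: nearW.
by apply/cvg_ex; eexists; exact: H.
Qed.

(** The integrals over bounded segments are increments of [F], and they increase
to the integral over the ray. *)
Lemma integral_ray_right_le F f (u M : R) : continuous f -> (forall x, 0 <= f x) ->
  (forall x : R, is_derive x 1 F (f x)) ->
  (forall v, u <= v -> F v - F u <= M) ->
  (\int[mu]_(x in `[u, +oo[) (f x)%:E <= M%:E)%E.
Proof.
move=> cf f0 dF FM.
have -> : `[u, +oo[%classic = \bigcup_n `[u, u + n%:R]%classic.
  apply/seteqP; split=> [x|x [n _]] /=; rewrite !in_itv/= ?andbT.
    move=> ux; exists (Num.trunc (x - u)).+1 => //=; rewrite in_itv/= ux/=.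
    by rewrite -lerBlDl ltW// truncnS_gt.
  by case/andP.
apply: integral_bigcup_le => //; first exact: continuous_measurable_fun.
  move=> n m nm; apply/subsetPset; apply: subset_itvl.
  by rewrite bnd_simp lerD2l ler_nat.
by move=> n; rewrite (ge0_integral_itv cf f0 dF) ?lee_fin ?FM// lerDl.
Qed.

Lemma integral_ray_left_le F f (u M : R) : continuous f -> (forall x, 0 <= f x) ->
  (forall x : R, is_derive x 1 F (f x)) ->
  (forall v, v <= u -> F u - F v <= M) ->
  (\int[mu]_(x in `]-oo, u]) (f x)%:E <= M%:E)%E.
Proof.
move=> cf f0 dF FM.
have -> : `]-oo, u]%classic = \bigcup_n `[u - n%:R, u]%classic.
  apply/seteqP; split=> [x|x [n _]] /=; rewrite !in_itv/=.
    move=> xu; exists (Num.trunc (u - x)).+1 => //=; rewrite in_itv/= xu/= andbT.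
    by rewrite lerBlDr -lerBlDl ltW// truncnS_gt.
  by case/andP.
apply: integral_bigcup_le => //; first exact: continuous_measurable_fun.
  move=> n m nm; apply/subsetPset; apply: subset_itvr.
  by rewrite bnd_simp lerD2l lerN2 ler_nat.
by move=> n; rewrite (ge0_integral_itv cf f0 dF) ?lee_fin ?FM// lerBlDr lerDl.
Qed.

Lemma indic_ray x t : \1_(`[x, +oo[) t = (x <= t)%R%:R :> R.
Proof. by rewrite indicE; congr (_%:R); rewrite mem_setE in_itv/= andbT. Qed.

(** Dominated convergence, with the majorant [|h|]. *)
Lemma kernel_cvg0 (h : R -> R) (K : nat -> R -> R) :
  mu.-integrable setT (EFin \o h) -> (forall n, measurable_fun setT (K n)) ->
  (forall n t, `|K n t| <= 1) -> (forall t, K n t @[n --> \oo] --> 0) ->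
  \int[mu]_t (K n t * h t) @[n --> \oo] --> 0.
Proof.
move=> ih mK K1 K0.
have mh : measurable_fun setT h by apply/measurable_EFinP; exact: measurable_int ih.
have iK n : mu.-integrable setT (fun t => (K n t * h t)%:E).
  have mKh : measurable_fun setT (fun t => K n t * h t) by exact: measurable_funM.
  apply: le_integrable ih => //; first exact/measurable_EFinP.
  by move=> t _ /=; rewrite lee_fin normrM ler_piMl.
rewrite /Rintegral.
have H : (\int[mu]_t (K n t * h t)%:E)%E @[n --> \oo] --> 0%:E.
  have m1 n := measurable_int _ (iK n).
  have c1 t : setT t -> (K n t * h t)%:E @[n --> \oo] --> (cst 0 t : \bar R)%E.
    move=> _; apply: cvg_EFin; first exact: nearW.
    by rewrite -[X in _ --> X](mul0r (h t)); apply: cvgMr_tmp; exact: K0.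
  have := dominated_cvg measurableT m1 c1 _ (integrable_abse ih) _.
  rewrite integral0; apply => //.
  by move=> n t _; rewrite lee_fin normrM ler_piMl.
exact: fine_cvg H.
Qed.

Lemma lebesgue_measure_segment (u v : R) : u <= v -> mu `[u, v] = (v - u)%:E.
Proof.
move=> uv; rewrite lebesgue_measure_itv/= lte_fin.
move: uv; rewrite le_eqVlt => /orP[/eqP ->|->]; last by rewrite EFinB.
by rewrite ltxx subrr.
Qed.

(** * Power integrals *)

(** If [c < u] then [u] is at most [u * (u / c) `^ (p - 1)].  This plays the
role of the inequalities of Young and Jensen, without sharp constants. *)
Lemma powR_young (p u c : R) : 1 <= p -> 0 <= u -> 0 < c ->
  u <= c + u `^ p / c `^ (p - 1).
Proof.
move=> p1 u0 c0; have p0 : 0 < p by lra.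
have cp : 0 < c `^ (p - 1) by exact: powR_gt0.
case: (leP u c) => uc.
  by rewrite (le_trans uc)// lerDl divr_ge0 ?powR_ge0.
rewrite -[leLHS]add0r; apply: lerD; first exact: ltW.
rewrite -mulr_powRB1// ler_pdivlMr// ler_wpM2l//.
by apply: ge0_ler_powR; rewrite ?nnegrE ?(ltW c0)//; [lra|exact: ltW].
Qed.

(** Take [l = Y `^ p^-1]; if [Y = 0], let [l] tend to 0. *)
Lemma powR_optimize (p u Y : R) : 1 <= p -> 0 <= u -> 0 <= Y ->
  (forall l : R, 0 < l -> u <= l + Y / l `^ (p - 1)) -> u `^ p <= 2 `^ p * Y.
Proof.
move=> p1 u0; have p0 : 0 < p by lra.
rewrite le_eqVlt => /orP[/eqP <-|Y0] H.
  have -> : u = 0.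
    apply/le_anti; rewrite u0 andbT; apply/ler_addgt0Pr => e e0.
    by have := H e e0; rewrite mul0r addr0 add0r.
  by rewrite powR0 ?gt_eqF// mulr0.
(* the two terms of the bound are equal for l = Y^(1/p) *)
have l0 : 0 < Y `^ p^-1 by exact: powR_gt0.
have lp : (Y `^ p^-1) `^ p = Y by rewrite -powRrM mulVf ?gt_eqF// powRr1// ltW.
have uY : u <= 2 * Y `^ p^-1.
  have e : Y / (Y `^ p^-1) `^ (p - 1) = Y `^ p^-1.
    rewrite -[X in X / _]lp -mulr_powRB1 ?(ltW l0)// mulfK//.
    by rewrite gt_eqF// powR_gt0.
  by have := H _ l0; rewrite e; lra.
rewrite -[X in _ <= _ * X]lp -powRM ?(ltW l0)//.
by apply: ge0_ler_powR; rewrite ?nnegrE ?(ltW p0)// mulr_ge0// ltW.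
Qed.

Definition power_integral (p : R) f : \bar R := (\int[mu]_x (`|f x| `^ p)%:E)%E.

Lemma power_integral_ge0 (p : R) f : (0 <= power_integral p f)%E.
Proof. by apply: integral_ge0 => x _; rewrite lee_fin powR_ge0. Qed.

Lemma Lnorm_power_integral (p : R) f :
  Lp_norm p%:E f = ((power_integral p f) `^ p^-1)%E.
Proof.
by rewrite /Lp_norm /= unlock.
Qed.

Lemma measurable_normr_powR (p : R) f : measurable_fun setT f ->
  measurable_fun setT (fun x => `|f x| `^ p).
Proof.
by move=> mf; apply: (measurableT_comp (measurable_powR p)); exact: measurableT_comp.
Qed.

(** For finite exponents everything is expressed by the integral of [|f|^p],
without the outer root. *)
Lemma Lp_spaceP (p : R) f : 1 <= p -> Lp_space p%:E f <->
  measurable_fun setT f /\ (power_integral p f < +oo)%E.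
Proof.
move=> p1; have p0 : 0 < p by exact: lt_le_trans p1.
have e : (Lnorm mu p%:E (EFin \o f) `^ p = power_integral p f)%E.
  rewrite -[Lnorm _ _ _]/(Lp_norm p%:E f) Lnorm_power_integral -poweRrM mulVf ?gt_eqF//.
  by rewrite poweRe1// power_integral_ge0.
have -> : Lp_space p%:E f = (f \in Lfun mu p%:E) by [].
split.
  rewrite inE => /andP[/[!inE]/= mf lpf]; split => //.
  by rewrite -e; exact: poweR_lty.
move=> [mf fp]; rewrite inE; apply/andP; split; rewrite inE//=.
rewrite /finite_norm -[Lnorm _ _ _]/(Lp_norm p%:E f) Lnorm_power_integral.
exact: poweR_lty.
Qed.

Lemma Lp_norm_power_le (p c : R) f y : 0 < p -> 0 < c ->
  (Lp_norm p%:E y <= c%:E * Lp_norm p%:E f)%E ->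
  (power_integral p y <= (c `^ p)%:E * power_integral p f)%E.
Proof.
move=> p0 c0; rewrite !Lnorm_power_integral => le.
have e h : (power_integral p h = ((power_integral p h) `^ p^-1) `^ p)%E.
  by rewrite -poweRrM mulVf ?gt_eqF// poweRe1// power_integral_ge0.
rewrite (e y) (e f) -poweR_EFin -poweRM ?poweR_ge0 ?lee_fin ?(ltW c0)//.
apply: (gt0_ler_poweR (ltW p0)) => //; rewrite in_itv/= leey andbT ?poweR_ge0//.
by rewrite mule_ge0 ?poweR_ge0// lee_fin ltW.
Qed.

(** Take for [f] the p-th root of the sum of the p-th powers of the bumps:
the integral of [|f|^p] is then a sum of areas even when the bumps overlap.
This sum is finite only almost everywhere. *)
Lemma bump_series (p e : R) (u v c : nat -> R) : 0 < p -> 0 < e ->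
  (forall n, u n <= v n) -> (forall n, 0 <= c n) ->
  (forall n, c n `^ p * (v n - u n) <= e / (2 ^ n.+1)%:R) ->
  exists f : R -> R, [/\ measurable_fun setT f, (power_integral p f < +oo)%E,
    forall x, 0 <= f x &
    {ae mu, forall x, forall n, u n <= x <= v n -> c n <= f x}].
Proof.
move=> p0 e0 uv c0 cb.
pose h n x : \bar R := (c n `^ p * \1_`[u n, v n] x)%:E.
have h0 n x : (0 <= h n x)%E by rewrite lee_fin mulr_ge0 ?powR_ge0// indicE.
have mh n : measurable_fun setT (h n).
  by apply/measurable_EFinP; apply: measurable_funM => //; exact: measurable_indic.
pose F x := (\sum_(0 <= n <oo) h n x)%E.
have F0 x : (0 <= F x)%E by apply: nneseries_ge0.
have mF : measurable_fun setT F.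
  by apply: (@ge0_emeasurable_sum _ _ R setT h xpredT).
have iF : (\int[mu]_x F x < +oo)%E.
  rewrite integral_nneseries//.
  apply: (@le_lt_trans _ _ (\sum_(0 <= n <oo) (e / (2 ^ n.+1)%:R)%:E)%E); last first.
    by apply: le_lt_trans (epsilon_trick0 _ (ltW e0)) _; exact: ltry.
  apply: lee_nneseries => [n _ _|n _]; first by apply: integral_ge0.
  rewrite /h; under eq_integral do rewrite EFinM.
  rewrite ge0_integralZl//=; last 2 first.
  - by apply/measurable_EFinP; exact: measurable_indic.
  - by rewrite lee_fin powR_ge0.
  have -> : (\int[mu]_x (\1_`[u n, v n] x)%:E = (v n - u n)%:E)%E.
    by rewrite integral_indic// setIT; exact: lebesgue_measure_segment.
  by rewrite -EFinM lee_fin; exact: cb.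
pose f x := fine (F x) `^ p^-1.
have fp x : `|f x| `^ p = fine (F x).
  by rewrite ger0_norm ?powR_ge0// -powRrM mulVf ?gt_eqF// powRr1// fine_ge0.
exists f; split.
- apply: (measurableT_comp (measurable_powR _)).
  by apply: measurableT_comp mF; exact: fine_measurable.
- apply: le_lt_trans iF; rewrite /power_integral.
  apply: ge0_le_integral => //=.
  + apply/measurable_EFinP.
    rewrite (_ : (fun x => _) = fun x => fine (F x)); last by apply/funext.
    by apply: measurableT_comp mF; exact: fine_measurable.
  + by move=> x _; rewrite fp; case: (F x) (F0 x) => //= y _; rewrite leey.
- by move=> x; exact: powR_ge0.
have Fint : mu.-integrable setT F.
  by apply/integrableP; split => //; under eq_integral do rewrite gee0_abs//.
apply: (aeS (integrable_ae measurableT Fint)) => x /(_ I) Ffin n xn.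
have cF : c n `^ p <= fine (F x).
  rewrite -lee_fin fineK// /F (nneseriesD1 (n := n))//.
  rewrite [leLHS](_ : _ = h n x); last first.
    by rewrite /h indicE mem_set ?mulr1//= in_itv.
  by rewrite leeDl// nneseries_ge0.
rewrite -[c n](powRr1 (c0 n)) -(mulfV (lt0r_neq0 p0)) powRrM.
by apply: ge0_ler_powR; rewrite ?nnegrE ?invr_ge0 ?(ltW p0) ?powR_ge0// fine_ge0.
Qed.

End RealAnalysis.

(** * The equation and its integrating factor *)

Section Equation.
Set Implicit Arguments.
Unset Strict Implicit.
Context {R : realType}.
Notation mu := (@lebesgue_measure R).
Context (r q Phi : R -> R) (r_gt0 : forall x, 0 < r x) (q_gt0 : forall x, 0 < q x)
  (r_cont : continuous r) (q_cont : continuous q)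
  (dPhi : forall x : R, is_derive x 1 Phi (q x / r x)).
Implicit Types (f g h y w : R -> R) (x t c k A : R).

(** The part of [is_solution] without the limits at infinity: functions that
serve for comparison, such as constants, do not vanish there. *)
Definition ode f y := locally_ac y /\
  {ae mu, forall x, derivable y x 1 /\ - r x * derive1 y x + q x * y x = f x}.

Lemma odeP f y : ode f y <-> locally_ac y /\
  {ae mu, forall x, is_derive x 1 y ((q x * y x - f x) / r x)}.
Proof.
split=> -[acy dy]; split => //; apply: (aeS dy) => x {dy}.
  move=> [dy eqy]; split => //; rewrite -eqy -derive1E.
  by field; rewrite gt_eqF.
move=> dy; split; first exact: ex_derive.
by rewrite derive1E derive_val; field; rewrite gt_eqF.
Qed.

Lemma odeB f g y w : ode f y -> ode g w -> ode (f \- g) (y \- w).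
Proof.
move=> /odeP[acy dy] /odeP[acw dw]; apply/odeP; split.
  have acN : locally_ac (fun x => - w x).
    move=> a b ab; apply: (@abs_continuous_on_dominated _ _ _ w w _ 1).
    - exact: acw.
    - exact: acw.
    move=> u v _ _ _; rewrite mul1r -opprD normrN -[leLHS]addr0; exact: lerD.
  exact: locally_acD.
apply: (aeS2 dy dw) => x {}dy {}dw.
have := is_deriveB dy dw; congr (is_derive _ _ _ _).
by rewrite /=; field; rewrite gt_eqF.
Qed.

Lemma ode_cst k : ode (fun x => k * q x) (fun=> k).
Proof.
apply/odeP; split.
  move=> a b ab; apply: (@abs_continuous_on_dominated _ _ _ id id _ 0).
  - exact: abs_continuous_on_id.
  - exact: abs_continuous_on_id.
  by move=> u v _ _ _; rewrite subrr normr0 mul0r.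
apply: aeW => x; rewrite (_ : _ / _ = 0); last by field; rewrite gt_eqF.
exact: is_derive_cst.
Qed.

Lemma Phi_continuous : continuous Phi.
Proof.
by move=> x; apply/differentiable_continuous/derivable1_diffP; exact: ex_derive.
Qed.

Lemma Phi_le x t : x <= t -> Phi x <= Phi t.
Proof.
rewrite le_eqVlt => /orP[/eqP -> //|xt].
have [|c _ ] := @MVT R Phi (fun x => q x / r x) x t xt (fun x _ => dPhi x).
  by apply: continuous_subspaceT; exact: Phi_continuous.
move=> H; rewrite -subr_ge0 H mulr_ge0 ?subr_ge0 ?(ltW xt)//.
by rewrite divr_ge0 ?ltW.
Qed.

Definition decay x := expR (- Phi x).

Lemma decay_gt0 x : 0 < decay x. Proof. exact: expR_gt0. Qed.

Lemma decay_le x t : x <= t -> decay t <= decay x.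
Proof. by move=> xt; rewrite ler_expR lerN2 Phi_le. Qed.

Lemma is_derive_decay x : is_derive x 1 decay (- (q x / r x) * decay x).
Proof.
by rewrite mulrC; apply: (@is_derive1_comp R expR (fun x => - Phi x)).
Qed.

Lemma decay_continuous : continuous decay.
Proof.
move=> x; apply/differentiable_continuous/derivable1_diffP.
by case: (is_derive_decay x).
Qed.

Lemma locally_ac_decay : locally_ac decay.
Proof.
apply: continuous_derive_locally_ac is_derive_decay _ => x.
apply: cvgM; last exact: decay_continuous.
apply: cvgN; apply: continuous_div r_cont _ _ => // t; by rewrite gt_eqF.
Qed.

Lemma is_derive_expPhi x :
  is_derive x 1 (fun x => expR (Phi x)) (q x / r x * expR (Phi x)).
Proof. by rewrite mulrC; apply: (@is_derive1_comp R expR Phi). Qed.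

Lemma expPhi_continuous : continuous (fun x => expR (Phi x)).
Proof.
by move=> x; apply: continuous_comp; [exact: Phi_continuous|exact: continuous_expR].
Qed.

Lemma ode_decay f y : ode f y -> locally_ac (y \* decay) /\
  {ae mu, forall x, is_derive x 1 (y \* decay) (- (decay x * f x / r x))}.
Proof.
move=> /odeP[acy dy]; split; first exact: locally_acM locally_ac_decay.
apply: (aeS dy) => x {}dy.
have := is_deriveM dy (is_derive_decay x); congr (is_derive _ _ _ _).
by rewrite /GRing.scale/=; field; rewrite gt_eqF.
Qed.

(** The derivative of [y * decay] is [- (decay * f / r)] almost everywhere, so
adding [c * x] keeps the function nonincreasing. *)
Lemma ode_decay_drop f y c (a b : R) : ode f y -> a <= b ->
  {ae mu, forall x, a <= x <= b -> c <= decay x * f x / r x} ->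
  y b * decay b + c * (b - a) <= y a * decay a.
Proof.
move=> /ode_decay[acz dz] ab cf.
have acc : locally_ac (fun x => c * x).
  apply: (@continuous_derive_locally_ac _ _ (fun=> c)); last exact: cst_continuous.
  by move=> x; rewrite -[c in is_derive _ _ _ c]mulr1; exact: is_deriveZ.
have := @abs_continuous_nonincreasing R a b ((y \* decay) \+ (fun x => c * x)) ab.
suff H : {ae mu, forall x, a <= x <= b ->
   derivable ((y \* decay) \+ (fun x => c * x)) x 1 /\
   derive1 ((y \* decay) \+ (fun x => c * x)) x <= 0}.
  move=> /(_ (locally_acD acz acc _) H) /=; lra.
apply: (aeS2 dz cf) => x {}dz {}cf xab.
have dc : is_derive x 1 (fun x => c * x) c.
  by rewrite -[c in is_derive _ _ _ c]mulr1; exact: is_deriveZ.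
have dD := is_deriveD dz dc.
split; first by case: dD.
by case: dD => _; rewrite derive1E => ->; have := cf xab; lra.
Qed.

(** [decay] is bounded near [+oo] because [Phi] is nondecreasing. *)
Lemma decay_cvg0 y : y x @[x --> +oo] --> 0 -> y x * decay x @[x --> +oo] --> 0.
Proof.
move=> y0; apply/cvgr0Pnorm_lt => e e0.
have e1 : 0 < e / decay 0 by rewrite divr_gt0 ?decay_gt0.
move/cvgr0Pnorm_lt : y0 => /(_ _ e1) ny.
near=> x.
rewrite normrM [X in _ * X]gtr0_norm ?decay_gt0//.
have x0 : 0 <= x by near: x; exact: nbhs_pinfty_ge.
apply: (@le_lt_trans _ _ (`|y x| * decay 0)).
  by rewrite ler_wpM2l// decay_le.
by rewrite -ltr_pdivlMr ?decay_gt0//; near: x.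
Unshelve. all: by end_near. Qed.

Lemma decay_cvg0N h : h x * decay x @[x --> +oo] --> 0 ->
  - h x * decay x @[x --> +oo] --> 0.
Proof.
move=> h0; rewrite -oppr0; under eq_cvg do rewrite mulNr; exact: cvgN.
Qed.

(** Comparison principle.  The product [w * decay] is nonincreasing, and at
[+oo] it is at least the limit 0 of [- h * decay].  The function [h] carries
the information at infinity when [w] itself has no limit there. *)
Lemma ode_ge0 g w h A : ode g w -> {ae mu, forall x, A <= x -> 0 <= g x} ->
  h x * decay x @[x --> +oo] --> 0 -> (forall x, A <= x -> - h x <= w x) ->
  forall x, A <= x -> 0 <= w x.
Proof.
move=> odew g0 h0 hw x Ax; rewrite -(pmulr_lge0 _ (decay_gt0 x)).
apply/ler_addgt0Pr => e e0.
move/cvgr0Pnorm_lt : h0 => /(_ _ e0) nh.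
have [t [xt ht]] : exists t, x <= t /\ `|h t * decay t| < e.
  near (+oo : set_system R) => t; exists t; split; last by near: t.
  by near: t; apply: nbhs_pinfty_ge; exact: num_real.
have := @ode_decay_drop g w 0 x t odew xt; rewrite mul0r addr0 => drop.
have {drop} drop : w t * decay t <= w x * decay x.
  apply: drop; apply: (aeS g0) => s gs /andP[xs _].
  rewrite divr_ge0 ?(ltW (r_gt0 _))// mulr_ge0 ?(ltW (decay_gt0 _))//.
  by rewrite gs// (le_trans Ax).
have : - h t * decay t <= w t * decay t.
  by rewrite ler_pM2r ?decay_gt0// hw// (le_trans Ax).
by have := ler_norm (h t * decay t); lra.
Unshelve. all: by end_near. Qed.

(** Two solutions differ by a multiple of [exp Phi], which the condition at
[+oo] excludes. *)
Lemma ode_unique f y1 y2 : ode f y1 -> ode f y2 ->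
  y1 x * decay x @[x --> +oo] --> 0 -> y2 x * decay x @[x --> +oo] --> 0 ->
  y1 = y2.
Proof.
move=> o1 o2 l1 l2.
have key u v : ode f u -> ode f v ->
  u x * decay x @[x --> +oo] --> 0 -> v x * decay x @[x --> +oo] --> 0 ->
  forall x, v x <= u x.
  move=> ou ov lu lv x; rewrite -subr_ge0.
  apply: (@ode_ge0 (f \- f) (u \- v) (v \- u) x) => //.
  - exact: odeB.
  - by apply: aeW => t _ /=; rewrite subrr.
  - rewrite -[0](subrr 0); under eq_cvg do rewrite mulrBl; exact: cvgB.
  - by move=> t _ /=; rewrite opprB.
by apply/funext => x; apply/le_anti/andP; split; apply: key.
Qed.

(** * The solution given by the Green kernel *)

Definition forcing f t := decay t * f t / r t.

Definition forcing_integrable f := measurable_fun setT f /\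
  forall x : R, mu.-integrable `[x, +oo[ (EFin \o forcing f).

Definition tail f x := \int[mu]_(t in `[x, +oo[) forcing f t.

Definition sol f x := expR (Phi x) * tail f x.

Lemma sol_decay f x : sol f x * decay x = tail f x.
Proof.
by rewrite /sol mulrAC /decay -expRD subrr expR0 mul1r.
Qed.

Lemma measurable_forcing f : measurable_fun setT f -> measurable_fun setT (forcing f).
Proof.
move=> mf; apply: measurable_funM.
  apply: measurable_funM => //.
  by apply: continuous_measurable_fun; exact: decay_continuous.
apply: continuous_measurable_fun => x; apply: cvgV; last exact: r_cont.
by rewrite gt_eqF.
Qed.

Lemma forcing_integrable_le f g : measurable_fun setT f ->
  (forall x, `|f x| <= g x) -> forcing_integrable g -> forcing_integrable f.
Proof.
move=> mf fg [mg ig]; split => // x; apply: le_integrable (ig x) => //.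
  apply/measurable_EFinP; apply: measurable_funS (measurable_forcing mf) => //.
move=> t _ /=; rewrite lee_fin /forcing !normrM.
rewrite ler_wpM2r// ler_wpM2l// (le_trans (fg t))//; exact: ler_norm.
Qed.

Lemma forcing_integrableD f g : forcing_integrable f -> forcing_integrable g ->
  forcing_integrable (fun x => f x + g x).
Proof.
move=> [mf fi] [mg gi]; split; first exact: measurable_funD.
move=> x; have := integrableD _ (fi x) (gi x).
rewrite (_ : ((EFin \o _) \+ _)%E = EFin \o forcing (fun x0 => f x0 + g x0)); first exact.
by apply/funext => t /=; rewrite -EFinD /forcing; congr EFin; ring.
Qed.

Lemma forcing_integrableZ k f : forcing_integrable f ->
  forcing_integrable (fun x => k * f x).
Proof.
move=> [mf fi]; split; first exact: measurable_funM.
move=> x; have := integrableZl _ k (fi x).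
rewrite (_ : (fun x => _) = EFin \o forcing (fun x0 => k * f x0)); first exact.
by apply/funext => t /=; rewrite -EFinM /forcing; congr EFin; ring.
Qed.

(** [- k * decay] is a primitive of the forcing, and it is bounded on right
rays. *)
Lemma forcing_integrable_q k : 0 <= k -> forcing_integrable (fun x => k * q x).
Proof.
move=> k0; split.
  apply: continuous_measurable_fun => x; apply: cvgM; [exact: cvg_cst|exact: q_cont].
move=> x; have f0 t : 0 <= forcing (fun x => k * q x) t.
  rewrite divr_ge0 ?(ltW (r_gt0 _))// mulr_ge0 ?(ltW (decay_gt0 _))//.
  by rewrite mulr_ge0// ltW.
have cf : continuous (forcing (fun x => k * q x)).
  move=> t; apply: cvgM; last by apply: cvgV; [rewrite gt_eqF|exact: r_cont].
  apply: cvgM; first exact: decay_continuous.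
  by apply: cvgM; [exact: cvg_cst|exact: q_cont].
have dF t : is_derive t 1 (fun t => - k * decay t) (forcing (fun x => k * q x) t).
  have := is_deriveZ (- k) (is_derive_decay t); congr (is_derive _ _ _ _).
  by rewrite /GRing.scale/= /forcing; field; rewrite gt_eqF.
apply/integrableP; split.
  by apply/measurable_EFinP; apply: measurable_funS (continuous_measurable_fun cf).
apply: (@le_lt_trans _ _ (k * decay x)%:E); last exact: ltry.
under eq_integral do rewrite /= ger0_norm//.
apply: integral_ray_right_le cf f0 dF _ => v xv.
by rewrite mulNr mulNr opprK addrC gerBl mulr_ge0// ltW// decay_gt0.
Qed.

Lemma forcing_locally_integrable f : forcing_integrable f ->
  locally_integrable [set: R] (forcing f).
Proof.
move=> [mf fi]; split; [exact: measurable_forcing|exact: openT|].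
move=> K _ cK; have [M [_ hM]] := compact_bounded cK.
have KM : K `<=` `[- (M + 1), +oo[.
  move=> x Kx; rewrite /= in_itv/= andbT.
  by have := hM (M + 1) (ltr_pwDr ltr01 (lexx _)) x Kx; rewrite /= ler_norml => /andP[].
have /integrableP[] // : mu.-integrable K (EFin \o forcing f).
by apply: integrableS (fi (- (M + 1))) => //; exact: compact_measurable.
Qed.

Lemma tail_primitive f : forcing_integrable f ->
  primitive (fun x => - tail f x) (forcing f).
Proof.
move=> [mf fi] u v uv.
have := @Rintegral_itvB R (forcing f) (BLeft u) (BInfty _ false) v (fi u) uv isT.
rewrite Rintegral_itv_obnd_cbnd -/(tail f u) -/(tail f v); first by move=> <-; ring.
apply: integrableS (fi v) => //.
by apply: subset_itvr; rewrite bnd_simp.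
Qed.

(** [sol f] is the product of [exp Phi] and of a primitive, up to sign, of the
forcing. *)
Lemma sol_ode f : forcing_integrable f -> ode f (sol f).
Proof.
move=> fi; have lf := forcing_locally_integrable fi; have pf := tail_primitive fi.
have acT : locally_ac (tail f).
  move=> u v uv; have acF := primitive_locally_ac lf pf uv.
  apply: (@abs_continuous_on_dominated _ _ _ _ _ _ 1 acF acF) => s t _ _ _.
  by rewrite mul1r -opprD normrN lerDl.
have acP : locally_ac (fun x => expR (Phi x)).
  apply: continuous_derive_locally_ac is_derive_expPhi _ => x.
  apply: cvgM; last exact: expPhi_continuous.
  by apply: continuous_div q_cont r_cont _ _ => t; rewrite gt_eqF.
apply/odeP; split; first exact: locally_acM.
apply: (aeS (primitive_ae_derive lf pf)) => x dT.
have := is_deriveM (is_derive_expPhi x) (is_deriveN dT).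
rewrite (_ : (fun x0 => expR (Phi x0)) * - (fun x0 => - tail f x0) = sol f); last first.
  by apply/funext => t; rewrite /sol -[LHS]/(expR (Phi t) * (- - tail f t)) opprK.
congr (is_derive _ _ _ _).
rewrite /GRing.scale/= -[(- _) x]/(- - tail f x) opprK /forcing /sol.
have e1 : expR (Phi x) * decay x = 1 by rewrite /decay -expRD subrr expR0.
rewrite (_ : _ * - _ = - (expR (Phi x) * decay x) * f x / r x); last first.
  by field; rewrite gt_eqF.
by rewrite e1; field; rewrite gt_eqF.
Qed.

(** Dominated convergence for the indicators of the rays from [u n], once the
forcing is cut off at 0. *)
Lemma tail_cvg0 f : forcing_integrable f -> tail f x @[x --> +oo] --> 0.
Proof.
move=> [mf fi]; apply/cvg_pinftyP => u uoo.
pose h := forcing f \_ `[0, +oo[.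
have ih : mu.-integrable setT (EFin \o h).
  by rewrite /h -restrict_EFin; apply/integrable_restrict => //=; rewrite setTI.
have mK n : measurable_fun setT (\1_(`[u n, +oo[) : R -> R) by exact: measurable_indic.
have K1 n t : `|\1_(`[u n, +oo[) t : R| <= 1.
  by rewrite indic_ray ger0_norm ?ler0n// lern1 leq_b1.
have K0 t : (\1_(`[u n, +oo[) t : R) @[n --> \oo] --> 0.
  apply: cvg_near_cst; near=> n; apply/eqP; rewrite indic_ray.
  suff : t < u n by rewrite ltNge => /negbTE ->.
  by near: n; exact: (cvgry_gt uoo).
have := kernel_cvg0 ih mK K1 K0.
apply: cvg_trans; apply: near_eq_cvg; near=> n.
have un0 : 0 <= u n by near: n; exact: (cvgry_ge uoo).
rewrite [RHS]/tail [RHS]Rintegral_mkcond; apply: eq_Rintegral => t _.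
rewrite /h !patchE indic_ray !mem_setE !in_itv/= !andbT.
case: (leP (u n) t) => ut; last by rewrite mul0r.
by rewrite mul1r (le_trans un0 ut).
Unshelve. all: by end_near. Qed.

Lemma sol_cvg0_decay f : forcing_integrable f -> sol f x * decay x @[x --> +oo] --> 0.
Proof.
move=> fi; apply: cvg_trans (tail_cvg0 fi); apply: near_eq_cvg.
by apply: nearW => x; rewrite sol_decay.
Qed.

Lemma sol_ge0 g : (forall x, 0 <= g x) -> forall x, 0 <= sol g x.
Proof.
move=> g0 x; rewrite mulr_ge0 ?expR_ge0//; apply: Rintegral_ge0 => t _.
by rewrite divr_ge0 ?(ltW (r_gt0 _))// mulr_ge0 ?(ltW (decay_gt0 _)).
Qed.

Lemma solZ k f x : forcing_integrable f -> sol (fun x => k * f x) x = k * sol f x.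
Proof.
move=> [mf fi]; rewrite /sol mulrCA; congr (_ * _); rewrite /tail -RintegralZl//.
by apply: eq_Rintegral => t _; rewrite /forcing; ring.
Qed.

Lemma sol_unique f y : forcing_integrable f -> is_solution r q f y -> y = sol f.
Proof.
move=> fi [acy eqy y0 _]; apply: (@ode_unique f) => //.
- exact: sol_ode.
- exact: decay_cvg0.
- exact: sol_cvg0_decay.
Qed.

(** Since [sol f] is the only candidate, the two clauses of correct solvability
reduce to properties of the operator [sol]. *)
Lemma correctly_solvable_sol (p : \bar R) (c : R) : 0 < c ->
  (forall f, Lp_space p f ->
    [/\ forcing_integrable f, sol f x @[x --> +oo] --> 0,
       sol f x @[x --> -oo] --> 0, Lp_space p (sol f) &
       (Lp_norm p (sol f) <= c%:E * Lp_norm p f)%E]) ->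
  correctly_solvable p r q.
Proof.
move=> c0 H; split=> [f /H[fi y1 y2 Ly _]|].
  exists (sol f); split=> [|y [_ /(sol_unique fi)//]].
  by split=> //; have [? ?] := sol_ode fi; split.
exists c => // f y Lf _; have [fi _ _ _ hn] := H f Lf.
by move=> /(sol_unique fi) ->.
Qed.

(** Compare [sol f] with [L + sol g] and with [- L - sol g], which solve the
equation with right-hand sides [L q + g] and [- L q - g]. *)
Lemma sol_dominated f g L A : forcing_integrable f -> forcing_integrable g ->
  (forall x, 0 <= g x) -> 0 <= L ->
  (forall x, A <= x -> `|f x| <= L * q x + g x) ->
  forall x, A <= x -> `|sol f x| <= L + sol g x.
Proof.
move=> fi gi g0 L0 fL x Ax; have sg := sol_ge0 g0.
have of_ := sol_ode fi; have og := sol_ode gi; have s0 := sol_cvg0_decay fi.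
have sN := decay_cvg0N s0.
have up : 0 <= sol g x - (sol f x - L).
  apply: (@ode_ge0 (g \- (f \- (fun x => L * q x)))
    (sol g \- (sol f \- (fun=> L))) (sol f) A) => //.
  - by apply: odeB => //; apply: odeB => //; exact: ode_cst.
  - by apply: aeW => t /fL; rewrite ler_norml => /andP[_] /=; lra.
  - by move=> t _ /=; have := sg t; lra.
have lo : 0 <= sol f x - (- L - sol g x).
  apply: (@ode_ge0 (f \- ((fun x => - L * q x) \- g))
    (sol f \- ((fun=> - L) \- sol g)) (fun x => - sol f x) A) => //.
  - by apply: odeB => //; apply: odeB => //; exact: ode_cst.
  - by apply: aeW => t /fL; rewrite ler_norml => /andP[+ _] /=; lra.
  - by move=> t _ /=; have := sg t; lra.
by rewrite ler_norml; apply/andP; split; lra.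
Qed.

Lemma sol_bound f L A : forcing_integrable f -> 0 <= L ->
  (forall x, A <= x -> `|f x| <= L * q x) -> forall x, A <= x -> `|sol f x| <= L.
Proof.
move=> fi L0 fL x Ax.
have i0 := forcing_integrable_q (lexx 0).
have := @sol_dominated f _ L A fi i0 _ L0 _ x Ax.
have -> : sol (fun x => 0 * q x) x = 0.
  rewrite /sol /tail (_ : forcing _ = cst 0) ?Rintegral_cst//.
    by rewrite mul0r mulr0.
  by apply/funext => t; rewrite /forcing mul0r mulr0 mul0r.
rewrite addr0; apply=> t; first by rewrite mul0r.
by move=> At; rewrite mul0r addr0 fL.
Qed.

(** On a left ray the value at the end point [A] replaces the condition at
infinity; its contribution dies out where [exp Phi] tends to 0. *)
Lemma sol_bound_left f L A : forcing_integrable f -> 0 <= L ->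
  (forall x, x <= A -> `|f x| <= L * q x) ->
  forall x, x <= A -> `|sol f x| <= L + `|sol f A| * decay A * expR (Phi x).
Proof.
move=> fi L0 fL x xA; have of_ := sol_ode fi.
have dx := decay_gt0 x; have dA := decay_gt0 A.
have up := @ode_decay_drop _ _ 0 x A (odeB (ode_cst L) of_) xA.
have lo := @ode_decay_drop _ _ 0 x A (odeB of_ (ode_cst (- L))) xA.
have H (g : R) t : 0 <= g -> 0 <= decay t * g / r t.
  by move=> g0; rewrite divr_ge0 ?(ltW (r_gt0 _))// mulr_ge0 ?(ltW (decay_gt0 _)).
have {}up : (L - sol f A) * decay A <= (L - sol f x) * decay x.
  move: up; rewrite mul0r addr0; apply; apply: aeW => t /andP[_ /fL].
  by rewrite ler_norml => /andP[_ ?]; apply: H => /=; lra.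
have {}lo : (sol f A + L) * decay A <= (sol f x + L) * decay x.
  move: lo; rewrite mul0r addr0 /= !opprK; apply; apply: aeW => t /andP[_ /fL].
  by rewrite ler_norml => /andP[? _]; apply: H => /=; lra.
have LA : 0 <= L * decay A by rewrite mulr_ge0// ltW.
have n1 : sol f A * decay A <= `|sol f A| * decay A by rewrite ler_pM2r// ler_norm.
have n2 : - sol f A * decay A <= `|sol f A| * decay A.
  by rewrite ler_pM2r// -normrN ler_norm.
have e1 : expR (Phi x) * decay x = 1 by rewrite /decay -expRD subrr expR0.
have -> : L + `|sol f A| * decay A * expR (Phi x) =
    (L * decay x + `|sol f A| * decay A) * expR (Phi x).
  by rewrite mulrDl -[L * _ * _]mulrA [decay x * _]mulrC e1 mulr1.
have -> : `|sol f x| = `|sol f x * decay x| * expR (Phi x).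
  by rewrite [in RHS]normrM (gtr0_norm dx) -[RHS]mulrA [decay x * _]mulrC e1 mulr1.
rewrite ler_wpM2r ?expR_ge0// ler_norml; apply/andP; split; lra.
Qed.

Definition kernel x t := \1_(`[x, +oo[) t * expR (Phi x - Phi t).

Lemma sol_kernel f x : forcing_integrable f ->
  sol f x = \int[mu]_t (kernel x t * (f t / r t)).
Proof.
move=> [mf fi]; rewrite /sol /tail -RintegralZl//.
rewrite [LHS]Rintegral_mkcond; apply: eq_Rintegral => t _.
rewrite patchE /kernel indic_ray mem_setE in_itv/= andbT.
case: (leP x t) => _; last by rewrite !mul0r.
by rewrite mul1r expRD /forcing /decay; ring.
Qed.

Lemma kernel_ge0 x t : 0 <= kernel x t.
Proof. by rewrite mulr_ge0 ?expR_ge0// indic_ray. Qed.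

Lemma kernel_le1 x t : `|kernel x t| <= 1.
Proof.
rewrite ger0_norm ?kernel_ge0// /kernel indic_ray.
case: (leP x t) => xt; last by rewrite mul0r.
by rewrite mul1r -expR0 ler_expR subr_le0 Phi_le.
Qed.

Lemma kernel_cvg_pinfty (u : R^nat) t : u n @[n --> \oo] --> +oo ->
  kernel (u n) t @[n --> \oo] --> 0.
Proof.
move=> uoo; apply: cvg_near_cst; near=> n; rewrite /kernel indic_ray.
suff : t < u n by rewrite ltNge => /negbTE ->; rewrite mul0r.
by near: n; exact: (cvgry_gt uoo).
Unshelve. all: by end_near. Qed.

Lemma measurable_kernel x : measurable_fun setT (kernel x).
Proof.
apply: measurable_funM; first exact: measurable_indic.
apply: continuous_measurable_fun => t.
apply: continuous_comp; last exact: continuous_expR.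
by apply: cvgB; [exact: cvg_cst|exact: Phi_continuous].
Qed.

Lemma measurable_kernel_left t : measurable_fun setT (kernel^~ t).
Proof.
rewrite (_ : kernel^~ t = fun x => \1_(`]-oo, t]) x * expR (Phi x - Phi t)).
  apply: measurable_funM; first exact: measurable_indic.
  apply: continuous_measurable_fun => x.
  apply: continuous_comp; last exact: continuous_expR.
  by apply: cvgB; [exact: Phi_continuous|exact: cvg_cst].
by apply/funext => x; rewrite /kernel indic_ray indicE mem_setE in_itv.
Qed.

Lemma kernelE x t :
  kernel x t = \1_[set z : R * R | z.1 <= z.2] (x, t) * expR (Phi x - Phi t).
Proof.
rewrite /kernel indic_ray indicE; congr (_%:R * _); congr nat_of_bool.
by apply/idP/idP => [xt|]; [rewrite inE|rewrite inE].
Qed.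

(** Joint measurability, as Tonelli's theorem requires. *)
Lemma measurable_kernel2 h : measurable_fun setT h ->
  measurable_fun setT (fun z : R * R => (kernel z.1 z.2 * h z.2)%:E).
Proof.
move=> mh; apply/measurable_EFinP.
have mPhi : measurable_fun setT Phi by exact: continuous_measurable_fun Phi_continuous.
apply: measurable_funM; last exact: measurableT_comp.
rewrite (_ : (fun _ => _) = (fun z : R * R =>
  \1_[set z : R * R | z.1 <= z.2] z * expR (Phi z.1 - Phi z.2))); last first.
  by apply/funext => -[x t]; rewrite kernelE.
apply: measurable_funM.
  apply: measurable_indic; rewrite -[X in measurable X]setTI.
  by apply: measurable_fun_le.
apply: measurableT_comp => //; apply: measurable_funB; exact: measurableT_comp.
Qed.

(** * The weight r^(1/p) q^(1/p') *)

Definition weight (p : R) x := r x `^ p^-1 * q x `^ (1 - p^-1).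

Lemma weight_powR (p : R) x : 0 < p -> weight p x `^ p = r x * q x `^ (p - 1).
Proof.
move=> p0; rewrite /weight powRM ?powR_ge0// -!powRrM mulVf ?gt_eqF//.
rewrite powRr1 ?(ltW (r_gt0 x))//; congr (_ * _ `^ _).
by field; rewrite gt_eqF.
Qed.

Lemma weight_lower_itv (p A B : R) : 1 <= p ->
  exists2 m : R, 0 < m & forall x, A <= x <= B -> m <= weight p x.
Proof.
move=> p1; have p0 : 0 < p by exact: lt_le_trans p1.
have [m1 m10 hm1] := @continuous_itv_lower R r A B r_cont r_gt0.
have [m2 m20 hm2] := @continuous_itv_lower R q A B q_cont q_gt0.
exists (m1 `^ p^-1 * m2 `^ (1 - p^-1)); first by rewrite mulr_gt0// powR_gt0.
move=> x xAB; have := hm1 x xAB; have := hm2 x xAB => m2q m1r.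
have pV1 : p^-1 <= 1 by rewrite invf_le1.
apply: ler_pM; rewrite ?powR_ge0//; apply: ge0_ler_powR;
  by rewrite ?nnegrE ?invr_ge0 ?subr_ge0 ?(ltW p0) ?(ltW m10) ?(ltW m20)
    ?(ltW (r_gt0 x)) ?(ltW (q_gt0 x)).
Qed.

(** Values of the weight below its minimum over [- B, B] are taken outside. *)
Lemma weight_small_far (p d B : R) : 1 <= p -> 0 < d ->
  (forall s : R, 0 < s -> exists x, weight p x < s) ->
  exists x, B < `|x| /\ weight p x < d.
Proof.
move=> p1 d0 inf0; have [m m0 hm] := weight_lower_itv (- B) B p1.
have [|x] := inf0 (Num.min m d); first by rewrite lt_min m0.
rewrite lt_min => /andP[xm xd]; exists x; split => //.
rewrite ltNge; apply/negP; rewrite ler_norml => /hm.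
by rewrite leNgt xm.
Qed.

(** * Slow variation of the coefficients *)

Context (a b alpha beta : R) (a_ge1 : 1 <= a) (b_gt0 : 0 < b)
  (alpha_lt_beta : alpha < beta)
  (slow : forall x : R, x \notin `]alpha, beta[ ->
     forall t : R, `|t - x| <= b * (r x / q x) ->
       (a^-1 <= r t / r x <= a) /\ (a^-1 <= q t / q x <= a))
  (small : a ^+ 2 * expR (- (b / a ^+ 2)) <= 3^-1).

Definition width x := r x / q x.

Lemma width_gt0 x : 0 < width x. Proof. by rewrite divr_gt0. Qed.

Lemma width_continuous : continuous width.
Proof. by apply: continuous_div => // x; rewrite gt_eqF. Qed.

Let a_gt0 : 0 < a. Proof. exact: lt_le_trans a_ge1. Qed.

Lemma slow_rq x t : x \notin `]alpha, beta[ -> `|t - x| <= b * width x ->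
  [/\ r t <= a * r x, r x <= a * r t, q t <= a * q x & q x <= a * q t].
Proof.
move=> xn tx; have [/andP[r1 r2] /andP[q1 q2]] := slow xn tx.
rewrite ler_pdivrMr// in r2; rewrite ler_pdivrMr// in q2.
rewrite ler_pdivlMr// mulrC ler_pdivrMr// mulrC in r1.
rewrite ler_pdivlMr// mulrC ler_pdivrMr// mulrC in q1.
by split.
Qed.

Let ratio_le (r1 r2 q1 q2 : R) : 0 < q1 -> 0 < q2 -> 0 < r1 ->
  r1 <= a * r2 -> q2 <= a * q1 -> r1 / q1 <= a ^+ 2 * (r2 / q2).
Proof.
move=> q10 q20 r10 hr hq.
rewrite (_ : a ^+ 2 * (r2 / q2) = (a * r2) * (a / q2)); last by field; rewrite gt_eqF.
apply: ler_pM => //; first exact: ltW.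
  by rewrite invr_ge0 ltW.
by rewrite ler_pdivlMr// mulrC ler_pdivrMr.
Qed.

Lemma slow_width x t : x \notin `]alpha, beta[ -> `|t - x| <= b * width x ->
  width t <= a ^+ 2 * width x /\ width x <= a ^+ 2 * width t.
Proof.
by move=> xn tx; have [? ? ? ?] := slow_rq xn tx; split; exact: ratio_le.
Qed.

Lemma bwidth_gt0 x : 0 < b * width x.
Proof. by rewrite mulr_gt0 ?width_gt0. Qed.

(** On the window, [q / r] is at least [1 / (a^2 * width x)]. *)
Lemma Phi_step x : x \notin `]alpha, beta[ ->
  b / a ^+ 2 <= Phi x - Phi (x - b * width x).
Proof.
move=> xn; have bw := bwidth_gt0 x.
have le : x - b * width x <= x by lra.
have := derive_lower (k := (a ^+ 2 * width x)^-1) dPhi le.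
rewrite (_ : _^-1 * _ = b / a ^+ 2); last first.
  by field; rewrite !gt_eqF ?width_gt0.
apply=> t /andP[t1 t2].
have tx : `|t - x| <= b * width x by rewrite ler_norml; apply/andP; split; lra.
have [wt _] := slow_width xn tx.
rewrite -[leRHS]invf_div lef_pV2// posrE; last exact: width_gt0.
by rewrite mulr_gt0 ?width_gt0// exprn_gt0.
Qed.

Lemma Phi_window x : x \notin `]alpha, beta[ ->
  Phi (x + b * width x) - Phi x <= b * a ^+ 2.
Proof.
move=> xn; have bw := bwidth_gt0 x.
have le : x <= x + b * width x by lra.
have := derive_upper (k := a ^+ 2 / width x) dPhi le.
rewrite (_ : _ / _ * _ = b * a ^+ 2); last first.
  by field; rewrite !gt_eqF ?width_gt0.
apply=> t /andP[t1 t2].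
have tx : `|t - x| <= b * width x by rewrite ler_norml; apply/andP; split; lra.
have [_ wt] := slow_width xn tx.
rewrite ler_pdivlMr ?width_gt0// mulrC -ler_pdivlMr ?divr_gt0// invf_div.
by rewrite -/(width t).
Qed.

Lemma notin_left x : x <= alpha -> x \notin `]alpha, beta[.
Proof. by move=> xa; rewrite in_itv/= negb_and -leNgt xa. Qed.

Lemma notin_right x : beta <= x -> x \notin `]alpha, beta[.
Proof. by move=> xb; rewrite in_itv/= negb_and -!leNgt xb orbT. Qed.

(** A value within [b / a^2] of an infimum over [x <= alpha] would be followed,
one window to the left, by a value below the infimum. *)
Lemma Phi_unbounded A : exists2 T : R, T <= alpha & Phi T < A.
Proof.
apply: contrapT => nT.
have PA x : x <= alpha -> A <= Phi x.
  by move=> xa; rewrite leNgt; apply/negP => PhiA; apply: nT; exists x.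
pose S := [set Phi x | x in [set x | x <= alpha]].
have hS : has_inf S.
  split; first by exists (Phi alpha), alpha => /=.
  by exists A => _ [x xa <-]; exact: PA.
have ba : 0 < b / a ^+ 2 by rewrite divr_gt0// exprn_gt0.
have [_ [t ta <-] ht] := inf_adherent ba hS.
have := Phi_step (notin_left ta); have bw := bwidth_gt0 t.
have : inf S <= Phi (t - b * width t).
  by apply: ge_inf; [case: hS|exists (t - b * width t) => //=; rewrite /= in ta; lra].
lra.
Qed.

Lemma expPhi_cvg0 k : k * expR (Phi t) @[t --> -oo] --> 0.
Proof.
rewrite -(mulr0 k); apply: cvgMl_tmp; apply/cvgr0Pnorm_lt => e e0.
have [T _ PT] := Phi_unbounded (ln e).
near=> t.
have tT : t <= T by near: t; apply: nbhs_ninfty_le; exact: num_real.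
rewrite gtr0_norm ?expR_gt0// -[ltRHS]lnK ?posrE// ltr_expR.
exact: le_lt_trans (Phi_le tT) PT.
Unshelve. all: by end_near. Qed.

Lemma kernel_cvg_ninfty (u : R^nat) t : u n @[n --> \oo] --> -oo ->
  kernel (u n) t @[n --> \oo] --> 0.
Proof.
move=> uoo; apply: (@squeeze_cvgr _ _ _ _ (cst 0) (fun n => decay t * expR (Phi (u n)))).
- near=> n; rewrite kernel_ge0/= /kernel expRD mulrC -/(decay t) mulrC mulrA.
  rewrite mulrC ler_wpM2l ?(ltW (decay_gt0 _))//.
  by rewrite ler_piMl ?expR_ge0// indic_ray lern1 leq_b1.
- exact: cvg_cst.
- by have /cvg_ninftyP/(_ _ uoo) := expPhi_cvg0 (decay t).
Unshelve. all: by end_near. Qed.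

(** With [rho t = (\int_N^t exp Phi) * decay t / width t], a step back by one
window to [t'] costs at most [b] and multiplies what remains by
[a^2 * exp (- (b / a^2)) <= 1 / 3]:  [rho t <= b + rho t' / 3].  At a maximum
of [rho] over [N, T] outside the interval from [alpha] to [beta] this gives
[rho <= 3 / 2 * b]; inside, compactness and the bound at [alpha] suffice.
Truncating at [N] makes the maximum exist, and the bound does not depend on
[N]. *)
Lemma expPhi_integral_le : exists2 C : R, 0 < C &
  forall G : R -> R, (forall x : R, is_derive x 1 G (expR (Phi x))) ->
  forall N t, N <= t -> (G t - G N) * decay t <= C * width t.
Proof.
have b0 := b_gt0.
have [m m0 hm] := @continuous_itv_lower R width alpha beta width_continuous width_gt0.
pose C1 := (beta - alpha + 3 / 2 * b * width alpha) / m.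
have C10 : 0 < C1.
  rewrite divr_gt0// addr_gt0 ?subr_gt0// mulr_gt0 ?width_gt0// mulr_gt0//; lra.
exists (3 / 2 * b + C1); first by rewrite addr_gt0// mulr_gt0//; lra.
move=> G dG N.
have Gc : continuous G.
  by move=> x; apply/differentiable_continuous/derivable1_diffP; case: (dG x).
have crude u v : u <= v -> (G v - G u) * decay v <= v - u.
  move=> uv; rewrite /decay expRN ler_pdivrMr ?expR_gt0// mulrC.
  apply: (derive_upper dG uv) => x /andP[_ xv].
  by rewrite ler_expR Phi_le.
have Gle u v : u <= v -> G u <= G v.
  move=> uv; rewrite -subr_ge0 -(mul0r (v - u)).
  by apply: (derive_lower dG uv) => x _; exact: expR_ge0.
pose rho t := (G t - G N) * decay t / width t.
have rhoc : continuous rho.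
  apply: (continuous_div _ width_continuous); last first.
    by move=> x; rewrite gt_eqF ?width_gt0.
  move=> x; apply: cvgM; last exact: decay_continuous.
  by apply: cvgB; [exact: Gc|exact: cvg_cst].
(* one window back, the smallness hypothesis turns M into M / 3 *)
have step t M : t \notin `]alpha, beta[ -> N <= t -> 0 <= M ->
    (forall s, N <= s <= t -> rho s <= M) -> rho t <= b + M / 3.
  move=> tn Nt M0 HM; have bw := bwidth_gt0 t.
  rewrite ler_pdivrMr ?width_gt0//.
  have tt : t - b * width t <= t by lra.
  have Mw : 0 <= M / 3 * width t by rewrite mulr_ge0 ?divr_ge0// ltW ?width_gt0.
  case: (leP N (t - b * width t)) => tN; last by have := crude _ _ Nt; lra.
  have := HM (t - b * width t); rewrite tN tt => /(_ isT).
  rewrite ler_pdivrMr ?width_gt0// => H1.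
  have H2 := crude _ _ tt.
  have tx : `|t - b * width t - t| <= b * width t.
    by rewrite (_ : _ - t = - (b * width t)) ?normrN ?gtr0_norm//; ring.
  have [H3 _] := slow_width tn tx.
  have : (G (t - b * width t) - G N) * decay t <= M / 3 * width t; last by lra.
  have -> : decay t =
      decay (t - b * width t) * expR (- (Phi t - Phi (t - b * width t))).
    by rewrite /decay -expRD; congr expR; ring.
  rewrite mulrA.
  apply: (@le_trans _ _ (M * width (t - b * width t) * expR (- (b / a ^+ 2)))).
    apply: ler_pM => //; rewrite ?expR_ge0//.
      by rewrite mulr_ge0 ?(ltW (decay_gt0 _))// subr_ge0 Gle.
    by rewrite ler_expR lerN2; exact: Phi_step.
  apply: (@le_trans _ _ (M * (a ^+ 2 * width t) * expR (- (b / a ^+ 2)))).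
    by rewrite ler_wpM2r ?expR_ge0// ler_wpM2l.
  have := ler_wpM2l (mulr_ge0 M0 (ltW (width_gt0 t))) small.
  lra.
have maxat T : N <= T -> exists2 c, N <= c <= T &
    0 <= rho c /\ forall s, N <= s <= T -> rho s <= rho c.
  move=> NT; have [c] := @EVT_max R rho N T NT (continuous_subspaceT rhoc).
  rewrite in_itv/= => cNT hc; exists c => //; split.
    have := hc N; rewrite in_itv/= lexx NT => /(_ isT).
    by rewrite {1}/rho subrr !mul0r.
  by move=> s sNT; apply: hc; rewrite in_itv.
(* at a maximum M = rho c the step reads M <= b + M / 3 *)
have at_max T c : N <= T -> c \notin `]alpha, beta[ -> N <= c <= T -> 0 <= rho c ->
   (forall s, N <= s <= T -> rho s <= rho c) -> rho c <= 3 / 2 * b.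
  move=> NT cn /andP[Nc cT] rc hc.
  have := step c (rho c) cn Nc rc.
  suff H s : N <= s <= c -> rho s <= rho c by move=> /(_ H); lra.
  by move=> /andP[Ns sc]; apply: hc; rewrite Ns (le_trans sc).
have left T : N <= T -> T <= alpha -> rho T <= 3 / 2 * b.
  move=> NT Ta; have [c cNT [rc hc]] := maxat T NT.
  apply: (@le_trans _ _ (rho c)); first by apply: hc; rewrite NT lexx.
  apply: (at_max T) => //; apply: notin_left; case/andP: cNT => _ cT.
  exact: le_trans Ta.
(* in the gap where nothing is assumed, start from the bound at alpha *)
have mid t : N <= t -> alpha <= t <= beta -> rho t <= C1.
  move=> Nt tab; have mt := hm _ tab; have /andP[at_ tb] := tab.
  have wa : 0 <= 3 / 2 * b * width alpha by rewrite mulr_ge0 ?(ltW (width_gt0 _))//; lra.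
  have num : (G t - G N) * decay t <= beta - alpha + 3 / 2 * b * width alpha.
    have := crude _ _ at_; have := crude _ _ Nt.
    case: (leP alpha N) => aN; first lra.
    have := left alpha (ltW aN) (lexx _); rewrite ler_pdivrMr ?width_gt0// => h1.
    have : (G alpha - G N) * decay t <= (G alpha - G N) * decay alpha.
      by rewrite ler_wpM2l ?decay_le// subr_ge0 Gle// ltW.
    lra.
  rewrite /rho /C1; apply: ler_pM => //.
  - by rewrite mulr_ge0 ?(ltW (decay_gt0 _))// subr_ge0 Gle.
  - by rewrite invr_ge0 ltW ?width_gt0.
  - by rewrite lef_pV2 ?posrE ?width_gt0.
move=> t Nt; rewrite -ler_pdivrMr ?width_gt0// -/(rho t).
have [c cNT [rc hc]] := maxat t Nt.
apply: (@le_trans _ _ (rho c)); first by apply: hc; rewrite Nt lexx.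
case: (boolP (c \in `]alpha, beta[)) => cab.
  apply: (@le_trans _ _ C1); last by rewrite lerDr mulr_ge0//; lra.
  move: cab; rewrite in_itv/= => /andP[c1 c2]; case/andP: cNT => Nc _.
  by apply: mid => //; rewrite !ltW.
by have := at_max t c Nt cab cNT rc hc; lra.
Qed.

Lemma kernel_integral_le : exists2 C : R, 0 < C &
  forall t, (\int[mu]_x (kernel x t)%:E <= (C * width t)%:E)%E.
Proof.
have [C C0 HC] := expPhi_integral_le; exists C => // t.
have [G dG] := continuous_antiderivative expPhi_continuous.
rewrite (_ : (\int[mu]_x (kernel x t)%:E =
  \int[mu]_(x in `]-oo, t]) (expR (Phi x) * decay t)%:E)%E).
  apply: (integral_ray_left_le (F := fun x => decay t * G x)).
  - by move=> x; apply: cvgM; [exact: expPhi_continuous|exact: cvg_cst].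
  - by move=> x; rewrite mulr_ge0 ?expR_ge0.
  - by move=> x; rewrite mulrC; exact: is_deriveZ.
  - by move=> v vt; rewrite -mulrBr mulrC; exact: HC.
rewrite [RHS]integral_mkcond; apply: eq_integral => x _.
rewrite patchE mem_setE in_itv/= /kernel indic_ray expRD -/(decay t).
by case: (leP x t) => _; rewrite ?mul1r// mul0r.
Qed.

Lemma kernel_tonelli : exists2 C : R, 0 < C &
  forall h, measurable_fun setT h -> (forall t, 0 <= h t) ->
  (\int[mu]_x \int[mu]_t (kernel x t * h t)%:E <=
   C%:E * \int[mu]_t (width t * h t)%:E)%E.
Proof.
have [C C0 HC] := kernel_integral_le; exists C => // h mh h0.
have kh x t : 0 <= kernel x t * h t by rewrite mulr_ge0// kernel_ge0.
have mw : measurable_fun setT (fun t => width t * h t).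
  by apply: measurable_funM => //; exact: continuous_measurable_fun width_continuous.
have wh t : 0 <= width t * h t by rewrite mulr_ge0// ltW// width_gt0.
have := @fubini_tonelli _ _ _ _ R mu mu _ (measurable_kernel2 mh) (fun z => kh z.1 z.2).
move=> /= ->.
rewrite -ge0_integralZl//=; last 3 first.
- exact/measurable_EFinP.
- by move=> t _; rewrite lee_fin.
- by rewrite lee_fin ltW.
apply: ge0_le_integral => //=.
- by move=> t _; apply: integral_ge0 => x _; rewrite lee_fin.
- exact: (measurable_fun_fubini_tonelli_G (m1 := mu) _ (measurable_kernel2 mh)
    (fun z => kh z.1 z.2)).
- by under eq_fun do rewrite -EFinM; apply/measurable_EFinP; exact: measurable_funM.
- move=> t _; under eq_integral do rewrite mulrC EFinM.
  rewrite ge0_integralZl//=; last 3 first.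
  + by apply/measurable_EFinP; exact: (measurable_kernel_left t).
  + by move=> x _; rewrite lee_fin kernel_ge0.
  + by rewrite lee_fin.
  rewrite [leRHS](_ : _ = (h t)%:E * (C * width t)%:E)%E; last first.
    by rewrite -!EFinM; congr EFin; ring.
  apply: lee_pmul; rewrite ?lee_fin//.
  by apply: integral_ge0 => x _; rewrite lee_fin kernel_ge0.
Qed.

(** A lower bound, after multiplication by [q], for a solution on the left half
of a window when the right-hand side is 1 on the window. *)
Definition kappa := b / (2 * a) * expR (- (b * a ^+ 2)).

Lemma kappa_gt0 : 0 < kappa.
Proof. by rewrite mulr_gt0 ?expR_gt0// divr_gt0// mulr_gt0. Qed.

(** [y] is nonnegative at the right end [x1] of the window, and between [x] and
[x1] the product [y * decay] falls at a rate at least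
[decay x1 * c / (a * r x0)].  As [Phi] grows by at most [b * a^2] on the window,
[decay x1] is comparable with [decay x0]. *)
Lemma ode_window_lower f y x0 c : ode f y -> y x @[x --> +oo] --> 0 ->
  x0 \notin `]alpha, beta[ -> 0 <= c -> {ae mu, forall x, 0 <= f x} ->
  {ae mu, forall x, x0 <= x <= x0 + b * width x0 -> c <= f x} ->
  forall x, x0 <= x <= x0 + b * width x0 / 2 -> c * (kappa / q x0) <= y x.
Proof.
move=> of_ y0 x0n c0 f0 fc x /andP[x0x xx].
have bw := bwidth_gt0 x0; set x1 := x0 + b * width x0.
have y_ge0 : 0 <= y x1.
  apply: (@ode_ge0 f y (fun x => - y x) x1) => //.
  - by apply: (aeS f0) => t ft _.
  - apply: decay_cvg0; rewrite -oppr0; exact: cvgN.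
  - by move=> t _; rewrite opprK.
have xx1 : x <= x1 by rewrite /x1; lra.
have d1 := decay_gt0 x1; have dx0 := decay_gt0 x0; have dx := decay_gt0 x.
have ar : 0 < a * r x0 by rewrite mulr_gt0.
pose k := decay x1 * c / (a * r x0).
have k0 : 0 <= k by rewrite !mulr_ge0 ?invr_ge0 ?(ltW ar)// ltW.
(* k bounds from below the decrease rate of y * decay on the window *)
have drop : y x1 * decay x1 + k * (x1 - x) <= y x * decay x.
  apply: (ode_decay_drop of_ xx1); apply: (aeS fc) => t {}fc /andP[xt tx1].
  have cf : c <= f t by apply: fc; rewrite tx1 (le_trans x0x).
  have tx0 : `|t - x0| <= b * width x0.
    by rewrite ler_norml; apply/andP; rewrite /x1 in tx1; split; lra.
  have [rt _ _ _] := slow_rq x0n tx0.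
  apply: ler_pM; rewrite ?invr_ge0 ?(ltW ar)//.
  - by rewrite mulr_ge0// ltW.
  - by apply: ler_pM => //; [exact: ltW|exact: decay_le].
  - by rewrite lef_pV2 ?posrE.
have h1 : k * (b * width x0 / 2) <= y x * decay x.
  have : k * (b * width x0 / 2) <= k * (x1 - x).
    by rewrite ler_wpM2l// /x1; lra.
  have : 0 <= y x1 * decay x1 by rewrite mulr_ge0// ltW.
  lra.
have h2 : y x * decay x <= y x * decay x0.
  rewrite ler_wpM2l ?decay_le//.
  rewrite -(pmulr_lge0 _ dx); apply: le_trans h1.
  by rewrite mulr_ge0//; lra.
rewrite -(ler_pM2r dx0); apply: le_trans h2; apply: le_trans h1.
rewrite (_ : k * _ = c * (b / (2 * a) * decay x1 / q x0)); last first.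
  by rewrite /k /width; field; rewrite !gt_eqF.
rewrite -[leLHS]mulrA ler_wpM2l// /kappa mulrAC ler_wpM2r ?invr_ge0 ?(ltW (q_gt0 _))//.
rewrite -[leLHS]mulrA ler_wpM2l//.
  by rewrite divr_ge0 ?(ltW b_gt0)// mulr_ge0// ltW.
rewrite /decay -expRD ler_expR.
have := Phi_window x0n; rewrite -/x1; lra.
Qed.

(** * Bounded continuous right-hand sides *)

Lemma cvg_infty_lower : q x @[x --> +oo] --> +oo -> q x @[x --> -oo] --> +oo ->
  exists2 k : R, 0 < k & forall x, k <= q x.
Proof.
move=> /cvgryPge/(_ 1)/near_pinfty_ray[B hB] /cvgryPge/(_ 1)/near_ninfty_ray[A hA].
have [m m0 hm] := @continuous_itv_lower R q A B q_cont q_gt0.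
exists (Num.min m 1); first by rewrite lt_min m0 ltr01.
move=> x; rewrite ge_min; case: (leP x A) => xA; first by rewrite hA ?orbT.
case: (leP B x) => xB; first by rewrite hB ?orbT.
by rewrite hm// !ltW.
Qed.

(** On a right ray where [q >= 2 M / e], the right-hand side is at most
[(e / 2) * q]. *)
Lemma sol_cvg_pinfty_sup f (M : R) : forcing_integrable f -> 0 < M ->
  (forall x, `|f x| <= M) -> q x @[x --> +oo] --> +oo -> sol f x @[x --> +oo] --> 0.
Proof.
move=> fi M0 fM qoo; apply/cvgr0Pnorm_lt => e e0.
have [A hA] : exists A, forall x, A <= x -> 2 * M / e <= q x.
  by apply: near_pinfty_ray; move/cvgryPge : qoo; exact.
have e2 : 0 <= e / 2 by lra.
have := sol_bound (L := e / 2) (A := A) fi e2.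
move=> H; near=> x; apply: (@le_lt_trans _ _ (e / 2)); last lra.
apply: H => [t At|]; last by near: x; apply: nbhs_pinfty_ge; exact: num_real.
apply: (le_trans (fM t)); have := hA _ At.
by rewrite ler_pdivrMr//; lra.
Unshelve. all: by end_near. Qed.

Lemma sol_cvg_ninfty_sup f (M : R) : forcing_integrable f -> 0 < M ->
  (forall x, `|f x| <= M) -> q x @[x --> -oo] --> +oo -> sol f x @[x --> -oo] --> 0.
Proof.
move=> fi M0 fM qoo; apply/cvgr0Pnorm_lt => e e0.
have [A hA] : exists A, forall x, x <= A -> 2 * M / e <= q x.
  by apply: near_ninfty_ray; move/cvgryPge : qoo; exact.
have e2 : 0 <= e / 2 by lra.
have := sol_bound_left (L := e / 2) (A := A) fi e2.
move=> H; have e20 : 0 < e / 2 by lra.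
have /cvgr0Pnorm_lt/(_ _ e20) := expPhi_cvg0 (`|sol f A| * decay A).
move=> small_tail.
near=> x.
have xA : x <= A by near: x; apply: nbhs_ninfty_le; exact: num_real.
have : `| `|sol f A| * decay A * expR (Phi x)| < e / 2 by near: x.
move=> /(le_lt_trans (ler_norm _)).
suff : `|sol f x| <= e / 2 + `|sol f A| * decay A * expR (Phi x) by lra.
apply: H => // t At; apply: (le_trans (fM t)); have := hA _ At.
by rewrite ler_pdivrMr//; lra.
Unshelve. all: by end_near. Qed.

Lemma correctly_solvable_infty_sufficient :
  q x @[x --> +oo] --> +oo -> q x @[x --> -oo] --> +oo ->
  correctly_solvable +oo%E r q.
Proof.
move=> qp qn; have [k k0 kq] := cvg_infty_lower qp qn.
have bnd f (M : R) : 0 < M -> (forall x, `|f x| <= M) -> forall x, `|f x| <= M / k * q x.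
  move=> M0 fM x; apply: (le_trans (fM x)).
  by rewrite mulrAC -mulrA ler_peMr ?(ltW M0)// ler_pdivlMr// mul1r.
apply: (@correctly_solvable_sol +oo%E k^-1); first by rewrite invr_gt0.
rewrite /Lp_space /Lp_norm eqxx => f [cf /bounded_fun_bound[M M0 fM]].
have fi : forcing_integrable f.
  have Mk : 0 <= M / k by rewrite divr_ge0// ltW.
  apply: (forcing_integrable_le (g := fun x => M / k * q x)).
  - exact: continuous_measurable_fun.
  - exact: bnd.
  - exact: forcing_integrable_q.
have solM (N : R) : 0 < N -> (forall x, `|f x| <= N) -> forall x, `|sol f x| <= N / k.
  move=> N0 fN x; apply: (@sol_bound f _ x) => //; first by rewrite divr_ge0// ltW.
  by move=> t _; exact: bnd.
split => //.
- exact: sol_cvg_pinfty_sup fM qp.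
- exact: sol_cvg_ninfty_sup fM qn.
- split; last exact: bound_bounded_fun (solM M M0 fM).
  by case: (sol_ode fi) => /locally_ac_continuous.
- set S := ereal_sup [set (`|f x|)%:E | x in [set: R]].
  have SM : (S <= M%:E)%E by apply: ge_ereal_sup => _ [x _ <-]; rewrite lee_fin.
  have fS x : (`|f x|%:E <= S)%E by apply: ereal_sup_ubound; exists x.
  have S0 : (0 <= S)%E by apply: le_trans (fS 0); rewrite lee_fin.
  have Sfin : S \is a fin_num by rewrite ge0_fin_numE// (le_lt_trans SM)// ltry.
  apply: ge_ereal_sup => _ [x _ <-]; rewrite -(fineK Sfin) -EFinM lee_fin.
  (* the supremum may be 0, while solM asks for a positive bound *)
  apply/ler_addgt0Pr => e e0.
  have ke : 0 < k * e by rewrite mulr_gt0.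
  have N0 : 0 < fine S + k * e by rewrite ltr_wpDl// fine_ge0.
  have fN t : `|f t| <= fine S + k * e.
    by rewrite -lee_fin EFinD fineK// (le_trans (fS t))// leeDl// lee_fin ltW.
  have := solM _ N0 fN x; rewrite mulrC mulrDr mulrA mulVf ?gt_eqF// mul1r.
  exact.
Qed.

Lemma correctly_solvable_infty_necessary : correctly_solvable +oo%E r q ->
  q x @[x --> +oo] --> +oo /\ q x @[x --> -oo] --> +oo.
Proof.
move=> [H _].
have [|y [[_ [acy dy yp yn]] _]] := H (fun=> 1).
  rewrite /Lp_space eqxx; split; first exact: cst_continuous.
  by apply: (@bound_bounded_fun R _ 1) => x; rewrite normr1.
have key x : x \notin `]alpha, beta[ -> kappa / q x <= y x.
  move=> xn; rewrite -[leLHS]mul1r.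
  apply: (ode_window_lower (f := fun=> 1) (y := y) (x0 := x)) => //.
  - exact: aeW.
  - exact: aeW.
  - by rewrite lexx/=; have := bwidth_gt0 x; lra.
have concl (A : R) x : x \notin `]alpha, beta[ -> `|y x| < kappa / (`|A| + 1) -> A <= q x.
  move=> xn /(le_lt_trans (ler_norm _)) /(le_lt_trans (key x xn)).
  have A1 : 0 < `|A| + 1 by rewrite ltr_wpDl.
  rewrite ltr_pM2l ?kappa_gt0// ltf_pV2 ?posrE// => Aq.
  by have := ler_norm A; lra.
have kA (A : R) : 0 < kappa / (`|A| + 1) by rewrite divr_gt0 ?kappa_gt0// ltr_wpDl.
split; apply/cvgryPge => A.
- move/cvgr0Pnorm_lt : yp => /(_ _ (kA A)) yA; near=> x.
  apply: concl; last by near: x.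
  by apply: notin_right; near: x; apply: nbhs_pinfty_ge; exact: num_real.
- move/cvgr0Pnorm_lt : yn => /(_ _ (kA A)) yA; near=> x.
  apply: concl; last by near: x.
  by apply: notin_left; near: x; apply: nbhs_ninfty_le; exact: num_real.
Unshelve. all: by end_near. Qed.

(** * Finite exponents: sufficiency *)

Section FiniteExponent.
Context (p sigma k : R) (p_ge1 : 1 <= p) (sigma_gt0 : 0 < sigma) (k_gt0 : 0 < k)
  (sigma_le : forall x, sigma <= weight p x) (k_le : forall x, k <= q x).

Let p_gt0 : 0 < p. Proof. exact: lt_le_trans p_ge1. Qed.

Let sigma_powR_le x : sigma `^ p <= r x * q x `^ (p - 1).
Proof.
rewrite -weight_powR//; apply: ge0_ler_powR => //; rewrite ?nnegrE ?ltW//.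
by rewrite mulr_gt0// powR_gt0.
Qed.

Context (f : R -> R) (mf : measurable_fun setT f)
  (If : mu.-integrable setT (fun x => (`|f x| `^ p)%:E)).

(** Chosen so that [g / r] is [|f|^p / weight^p]. *)
Let g x := `|f x| `^ p / q x `^ (p - 1).

Let g_ge0 x : 0 <= g x. Proof. by rewrite divr_ge0 ?powR_ge0. Qed.

Let mfp : measurable_fun setT (fun x => `|f x| `^ p).
Proof. exact: measurable_normr_powR. Qed.

Let measurable_g : measurable_fun setT g.
Proof.
apply: measurable_funM => //.
rewrite (_ : (fun _ => _) = (fun x => q x `^ - (p - 1))); last first.
  by apply/funext => x; rewrite powRN.
by apply: (measurableT_comp (measurable_powR _)); exact: continuous_measurable_fun.
Qed.

(** This is where the lower bound on the weight acts: [g / r] becomes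
integrable on the whole line. *)
Let g_div_le x : g x / r x <= (sigma `^ p)^-1 * `|f x| `^ p.
Proof.
have s0 : 0 < sigma `^ p by exact: powR_gt0.
rewrite /g -mulrA -invfM mulrC ler_wpM2r ?powR_ge0//.
rewrite lef_pV2 ?posrE//; first by rewrite mulrC sigma_powR_le.
by rewrite mulr_gt0// powR_gt0.
Qed.

Let integrable_g_div : mu.-integrable setT (EFin \o (fun x => g x / r x)).
Proof.
have mr : measurable_fun setT (fun x => g x / r x).
  apply: measurable_funM => //; apply: continuous_measurable_fun => x.
  by apply: cvgV; [rewrite gt_eqF|exact: r_cont].
have := integrableZl measurableT (sigma `^ p)^-1 If; apply: le_integrable => //.
  exact/measurable_EFinP.
move=> x _ /=; have gr0 : 0 <= g x / r x by apply: divr_ge0; [exact: g_ge0|exact/ltW/r_gt0].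
rewrite lee_fin ger0_norm//.
by rewrite (le_trans (g_div_le x))// ler_norm.
Qed.

Let forcing_g : forcing_integrable g.
Proof.
split=> // x.
have := integrableZl measurableT (decay x) integrable_g_div.
move=> iZ; have : mu.-integrable `[x, +oo[
    (fun t => (decay x)%:E * (EFin \o (fun s => (g s / r s)%R)) t)%E.
  exact: integrableS iZ.
apply: le_integrable => //.
  by apply/measurable_EFinP; apply: measurable_funS (measurable_forcing measurable_g).
move=> t /=; rewrite in_itv/= andbT => xt; rewrite lee_fin /forcing -mulrA !normrM.
by rewrite ler_wpM2r// !gtr0_norm ?decay_gt0// decay_le.
Qed.

Let forcing_f : forcing_integrable f.
Proof.
apply: (forcing_integrable_le mf (g := fun x => 1 * q x + g x)).
  by move=> x; rewrite mul1r; exact: powR_young.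
by apply: forcing_integrableD => //; exact: forcing_integrable_q.
Qed.

Let sol_f_le x l : 0 < l -> `|sol f x| <= l + sol g x / l `^ (p - 1).
Proof.
move=> l0; rewrite [X in _ + X]mulrC -solZ//.
apply: (@sol_dominated f (fun x => (l `^ (p - 1))^-1 * g x) l x) => //.
- exact: forcing_integrableZ.
- by move=> t; rewrite mulr_ge0 ?invr_ge0 ?powR_ge0.
- exact: ltW.
- move=> t _; have := powR_young p_ge1 (normr_ge0 (f t)) (mulr_gt0 l0 (q_gt0 t)).
  rewrite powRM ?(ltW l0) ?(ltW (q_gt0 t))// /g; congr (_ <= _ + _).
  by rewrite invfM mulrC -mulrA [X in _ = X]mulrCA mulrA mulrC mulrA.
Qed.

Let sol_f_powR x : `|sol f x| `^ p <= 2 `^ p * sol g x.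
Proof.
by apply: powR_optimize => //; [exact: sol_ge0|move=> l l0; exact: sol_f_le].
Qed.

Let sol_g_cvg (F : set_system R) {FF : Filter F} : sol g x @[x --> F] --> 0 ->
  sol f x @[x --> F] --> 0.
Proof.
move=> g0; apply/cvgr0Pnorm_lt => e e0; have e20 : 0 < e / 2 by lra.
pose E := (e / 2) `^ (p - 1); have E0 : 0 < E by exact: powR_gt0.
have eE : 0 < e / 2 * E by rewrite mulr_gt0.
move/cvgr0Pnorm_lt : g0 => /(_ _ eE) gE; near=> x.
have : `|sol g x| < e / 2 * E by near: x.
rewrite ger0_norm ?sol_ge0// -ltr_pdivrMr// => H.
by apply: le_lt_trans (sol_f_le x e20) _; rewrite -/E; lra.
Unshelve. all: by end_near. Qed.

Let sol_g_pinfty : sol g x @[x --> +oo] --> 0.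
Proof.
apply/cvg_pinftyP => u uoo.
rewrite (_ : (fun n => sol g (u n)) = fun n => \int[mu]_t (kernel (u n) t * (g t / r t))).
  apply: kernel_cvg0 => // [n|n t|t]; [exact: measurable_kernel|exact: kernel_le1|].
  exact: kernel_cvg_pinfty.
by apply/funext => n; exact: sol_kernel.
Qed.

Let sol_g_ninfty : sol g x @[x --> -oo] --> 0.
Proof.
apply/cvg_ninftyP => u uoo.
rewrite (_ : (fun n => sol g (u n)) = fun n => \int[mu]_t (kernel (u n) t * (g t / r t))).
  apply: kernel_cvg0 => // [n|n t|t]; [exact: measurable_kernel|exact: kernel_le1|].
  exact: kernel_cvg_ninfty.
by apply/funext => n; exact: sol_kernel.
Qed.

Let sol_continuous : continuous (sol f).
Proof. by case: (sol_ode forcing_f) => /locally_ac_continuous. Qed.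

(** The kernel integrates in [x] to at most [C * r / q], and
[r / q * (g / r)] is [|f|^p / q^p]. *)
Let sol_g_integral (C : R) : 0 < C ->
  (forall h, measurable_fun setT h -> (forall t, 0 <= h t) ->
  (\int[mu]_x \int[mu]_t (kernel x t * h t)%:E <=
   C%:E * \int[mu]_t (width t * h t)%:E)%E) ->
  (\int[mu]_x (sol g x)%:E <= (C / k `^ p)%:E * \int[mu]_x (`|f x| `^ p)%:E)%E.
Proof.
move=> C0 HC.
have mr : measurable_fun setT (fun x => g x / r x).
  by have /measurable_EFinP := measurable_int _ integrable_g_div.
have gr0 x : 0 <= g x / r x by apply: divr_ge0; [exact: g_ge0|exact/ltW/r_gt0].
have kp : 0 < k `^ p by exact: powR_gt0.
rewrite (_ : (\int[mu]_x (sol g x)%:E =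
  \int[mu]_x \int[mu]_t (kernel x t * (g t / r t))%:E)%E); last first.
  apply: eq_integral => x _; rewrite sol_kernel// /Rintegral fineK//.
  apply: integrable_fin_num => //; apply: le_integrable integrable_g_div => //.
    by apply/measurable_EFinP; apply: measurable_funM => //; exact: measurable_kernel.
  by move=> t _ /=; rewrite lee_fin normrM ler_piMl// kernel_le1.
apply: (le_trans (HC _ mr gr0)).
rewrite EFinM -muleA; apply: lee_wpmul2l; first by rewrite lee_fin ltW.
rewrite -ge0_integralZl//=; last 2 first.
- exact/measurable_EFinP.
- by rewrite lee_fin invr_ge0 ltW.
apply: ge0_le_integral => //=.
- by move=> x _; rewrite lee_fin mulr_ge0// ltW// width_gt0.
- apply/measurable_EFinP; apply: measurable_funM => //.
  exact: continuous_measurable_fun width_continuous.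
- by apply/measurable_EFinP; exact: measurable_funM.
- move=> x _; rewrite lee_fin.
  have -> : width x * (g x / r x) = (q x `^ p)^-1 * `|f x| `^ p.
    rewrite /width /g -(mulr_powRB1 (ltW (q_gt0 x)) p_gt0); field.
    by rewrite !gt_eqF// powR_gt0.
  rewrite ler_wpM2r ?powR_ge0// lef_pV2 ?posrE ?powR_gt0//.
  by apply: ge0_ler_powR; rewrite ?nnegrE ?(ltW p_gt0) ?(ltW k_gt0) ?(ltW (q_gt0 x)).
Qed.

Lemma sol_in_Lp (C : R) : 0 < C ->
  (forall h, measurable_fun setT h -> (forall t, 0 <= h t) ->
  (\int[mu]_x \int[mu]_t (kernel x t * h t)%:E <=
   C%:E * \int[mu]_t (width t * h t)%:E)%E) ->
  [/\ forcing_integrable f, sol f x @[x --> +oo] --> 0, sol f x @[x --> -oo] --> 0,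
    measurable_fun setT (sol f) &
    (power_integral p (sol f) <= (2 `^ p * (C / k `^ p))%:E * power_integral p f)%E].
Proof.
move=> C0 HC; have msol := continuous_measurable_fun sol_continuous.
split => //; [exact: sol_g_cvg|exact: sol_g_cvg|].
have msg : measurable_fun setT (sol g).
  by apply: continuous_measurable_fun; case: (sol_ode forcing_g) => /locally_ac_continuous.
rewrite EFinM -muleA; apply: le_trans (lee_wpmul2l _ (sol_g_integral C0 HC)); last first.
  by rewrite lee_fin powR_ge0.
rewrite -ge0_integralZl//=; last 2 first.
- exact/measurable_EFinP.
- by move=> x _; rewrite lee_fin sol_ge0.
apply: ge0_le_integral => //=.
- by apply/measurable_EFinP; exact: measurable_normr_powR.
- by apply/measurable_EFinP; exact: measurable_funM.
- by move=> x _; rewrite -EFinM lee_fin.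
Qed.

End FiniteExponent.

Lemma correctly_solvable_finite_sufficient (p sigma k : R) : 1 <= p ->
  0 < sigma -> (forall x, sigma <= weight p x) ->
  0 < k -> (forall x, k <= q x) -> correctly_solvable p%:E r q.
Proof.
move=> p1 s0 sle k0 kle; have p0 : 0 < p by exact: lt_le_trans p1.
have [C C0 HC] := kernel_tonelli.
pose K := 2 `^ p * (C / k `^ p).
have K0 : 0 < K by rewrite mulr_gt0 ?divr_gt0// powR_gt0.
apply: (@correctly_solvable_sol p%:E (K `^ p^-1)); first exact: powR_gt0.
move=> f /[dup] Lf /(Lp_spaceP _ p1)[mf fp].
have If : mu.-integrable setT (fun x => (`|f x| `^ p)%:E).
  apply/integrableP; split; first by apply/measurable_EFinP; exact: measurable_normr_powR.
  by under eq_integral do rewrite gee0_abs ?lee_fin ?powR_ge0//.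
have [fi yp yn msol le] := sol_in_Lp p1 s0 k0 sle kle mf If C0 HC.
split => //.
  apply/(Lp_spaceP _ p1); split => //; apply: (le_lt_trans le).
  by rewrite lte_mul_pinfty// lee_fin ltW.
rewrite !Lnorm_power_integral -poweR_EFin -poweRM ?power_integral_ge0 ?lee_fin ?(ltW K0)//.
have pV0 : 0 <= p^-1 by rewrite invr_ge0 ltW.
apply: (gt0_ler_poweR pV0) => //; rewrite in_itv/= leey andbT ?power_integral_ge0//.
by rewrite mule_ge0 ?power_integral_ge0// lee_fin ltW.
Qed.

(** * Finite exponents: necessity *)

(** For the indicator of a window at [x0] the p-th power integral is the length
of the window, while the solution is at least [kappa / q x0] on half of it. *)
Lemma q_lower_necessary (p : R) : 1 <= p -> correctly_solvable p%:E r q ->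
  exists2 k : R, 0 < k & forall x, k <= q x.
Proof.
move=> p1 [ex [c c0 hc]]; have p0 : 0 < p by exact: lt_le_trans p1.
have [m m0 hm] := @continuous_itv_lower R q alpha beta q_cont q_gt0.
have kap := kappa_gt0.
exists (Num.min m (kappa / (2 * c))); first by rewrite lt_min m0 divr_gt0// mulr_gt0.
move=> x0; rewrite ge_min.
case: (boolP (x0 \in `]alpha, beta[)) => x0n.
  by move: x0n; rewrite in_itv/= => /andP[h1 h2]; rewrite hm// !ltW.
apply/orP; right.
have bw := bwidth_gt0 x0.
pose I := `[x0, x0 + b * width x0]%classic.
pose f : R -> R := \1_I.
have mI : measurable I by exact: measurable_itv.
have mf : measurable_fun setT f by exact: measurable_indic.
have pf : power_integral p f = (b * width x0)%:E.
  rewrite /power_integral (_ : (fun x => _) = (fun x => (\1_I x)%:E)).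
    rewrite integral_indic// setIT.
    have -> : b * width x0 = x0 + b * width x0 - x0 by ring.
    by apply: lebesgue_measure_segment; rewrite lerDl ltW.
  apply/funext => x; rewrite /f indicE; case: (x \in I) => /=.
    by rewrite normr1 powR1.
  by rewrite normr0 powR0// gt_eqF.
have Lf : Lp_space p%:E f by apply/(Lp_spaceP _ p1); split => //; rewrite pf ltry.
have [y [[Ly sy] _]] := ex f Lf.
have [acy eqy yp _] := sy.
have := Lp_norm_power_le p0 c0 (hc f y Lf Ly sy).
rewrite pf -EFinM => le.
have f0 x : 0 <= f x by rewrite /f indicE.
have yl x : x0 <= x <= x0 + b * width x0 / 2 -> kappa / q x0 <= y x.
  move=> xJ; rewrite -[leLHS]mul1r.
  apply: (ode_window_lower (f := f) (y := y)) xJ => //.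
  - exact: aeW.
  - by apply: aeW => t tI; rewrite /f indicE mem_set.
have kq : 0 < kappa / q x0 by rewrite divr_gt0.
pose J := `[x0, x0 + b * width x0 / 2]%classic.
have mJ : measurable J by exact: measurable_itv.
have low : (((kappa / q x0) `^ p * (b * width x0 / 2))%:E <= power_integral p y)%E.
  have -> : (((kappa / q x0) `^ p * (b * width x0 / 2))%:E =
      \int[mu]_(x in J) (cst ((kappa / q x0) `^ p)%:E x))%E.
    rewrite integral_cst//= lebesgue_measure_segment ?lerDl ?divr_ge0 ?(ltW bw)//.
    by rewrite -EFinM; congr ((_ * _)%:E); ring.
  have my := measurable_normr_powR p
    (continuous_measurable_fun (locally_ac_continuous acy)).
  apply: (@le_trans _ _ (\int[mu]_(x in J) (`|y x| `^ p)%:E)%E).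
    apply: ge0_le_integral => //=.
    - by move=> x _; rewrite lee_fin powR_ge0.
    - by apply/measurable_EFinP; exact: measurable_funS my.
    - move=> x; rewrite /J/= in_itv/= => /yl kx; rewrite lee_fin.
      apply: ge0_ler_powR; rewrite ?nnegrE ?(ltW p0) ?(ltW kq)//.
      by rewrite (le_trans kx)// ler_norm.
  by apply: ge0_subset_integral => //; exact/measurable_EFinP.
have := le_trans low le; rewrite lee_fin mulrA.
rewrite [X in X <= _](_ : _ = (kappa / q x0) `^ p / 2 * (b * width x0)); last by ring.
rewrite ler_pM2r// ler_pdivrMr// => kp.
have : kappa / q x0 <= 2 * c.
  rewrite leNgt; apply/negP => lt2.
  have c20 : 0 < 2 * c by rewrite mulr_gt0.
  have : (2 * c) `^ p < (kappa / q x0) `^ p by apply: gt0_ltr_powR; rewrite ?nnegrE ?ltW.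
  rewrite powRM ?(ltW c0)// => /(lt_le_trans)/(_ kp); rewrite mulrC ltr_pM2l ?powR_gt0//.
  rewrite ltNge -{1}[2]powRr1// => /negP; apply.
  by apply: ler_powR => //; rewrite ler1n.
by rewrite ler_pdivrMr// ler_pdivrMr ?mulr_gt0// mulrC.
Qed.

(** If the weight had infimum 0, bumps of height [q (x_ n)] over the windows at
[x_ n] would keep the solution above [kappa] along [x_].  The p-th power
integral of such a bump is [b * weight^p], which is summable for a suitable
[x_] going to infinity. *)
Lemma weight_lower_necessary (p : R) : 1 <= p -> correctly_solvable p%:E r q ->
  exists2 s : R, 0 < s & forall x, s <= weight p x.
Proof.
move=> p1 [ex _]; have p0 : 0 < p by exact: lt_le_trans p1.
apply: contrapT => nex.
have inf0 (s : R) : 0 < s -> exists x, weight p x < s.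
  move=> s0; apply: contrapT => nx; apply: nex; exists s => // x.
  by rewrite leNgt; apply/negP => xs; apply: nx; exists x.
have d0 n : 0 < ((2 ^ n.+1)%:R^-1 : R) `^ p^-1 by rewrite powR_gt0// invr_gt0 ltr0n expn_gt0.
have [x_ Hx] := choice (fun n =>
  weight_small_far (n%:R + `|alpha| + `|beta|) p1 (d0 n) inf0).
have xfar n : n%:R < `|x_ n|.
  by have [+ _] := Hx n; apply: le_lt_trans; rewrite -addrA lerDl addr_ge0.
have xnotin n : x_ n \notin `]alpha, beta[.
  have [+ _] := Hx n; case: (ltP 0 (x_ n)) => x0.
    rewrite (gtr0_norm x0) => xn; apply: notin_right.
    have := ler0n R n; have := normr_ge0 alpha; have := ler_norm beta; lra.
  rewrite (ler0_norm x0) => xn; apply: notin_left.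
  have := ler0n R n; have := normr_ge0 beta; have := ler_norm (- alpha); rewrite normrN; lra.
have uv n : x_ n <= x_ n + b * width (x_ n) by have := bwidth_gt0 (x_ n); lra.
have q0 n : 0 <= q (x_ n) by exact: ltW.
have cb n : q (x_ n) `^ p * (x_ n + b * width (x_ n) - x_ n) <= b / (2 ^ n.+1)%:R.
  (* by the choice of the heights, the bump has p-th power integral b weight^p *)
  rewrite (_ : _ * _ = b * weight p (x_ n) `^ p); last first.
    rewrite weight_powR// -(mulr_powRB1 (ltW (q_gt0 (x_ n))) p0) /width.
    by field; rewrite gt_eqF.
  rewrite ler_wpM2l ?(ltW b_gt0)//.
  have [_ /ltW xd] := Hx n.
  have -> : ((2 ^ n.+1)%:R^-1 : R) = ((2 ^ n.+1)%:R^-1 `^ p^-1) `^ p.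
    by rewrite -powRrM mulVf ?gt_eqF// powRr1// invr_ge0 ler0n.
  apply: ge0_ler_powR; rewrite ?nnegrE ?(ltW p0) ?powR_ge0//.
  by rewrite mulr_ge0 ?powR_ge0.
have [f [mf pf f0 fx]] := bump_series p0 b_gt0 uv q0 cb.
have Lf : Lp_space p%:E f by apply/(Lp_spaceP _ p1).
have [y [[_ sy] _]] := ex f Lf; have [acy eqy yp yn] := sy.
(* height and gain cancel: y does not tend to 0 along x_ *)
have yk n : kappa <= y (x_ n).
  have -> : kappa = q (x_ n) * (kappa / q (x_ n)) by rewrite mulrC divfK// gt_eqF.
  apply: (ode_window_lower (f := f) (y := y) (x0 := x_ n)) => //.
  - exact: aeW.
  - by apply: (aeS fx) => t; exact.
  - by rewrite lexx/=; have := bwidth_gt0 (x_ n); lra.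
move/cvgr0Pnorm_lt : yp => /(_ _ kappa_gt0)/near_pinfty_ray[A hA].
move/cvgr0Pnorm_lt : yn => /(_ _ kappa_gt0)/near_ninfty_ray[A' hA'].
pose n := (Num.trunc (`|A| + `|A'|)).+1.
have nA : `|A| + `|A'| < n%:R by exact: truncnS_gt.
have := lt_trans nA (xfar n).
have := yk n; have := ler_norm (y (x_ n)).
case: (ltP 0 (x_ n)) => x0.
  rewrite (gtr0_norm x0) => h1 h2 h3; have := hA (x_ n).
  have := ler_norm A; have := normr_ge0 A' => h4 h5 H.
  have : `|y (x_ n)| < kappa by apply: H; lra.
  lra.
rewrite (ler0_norm x0) => h1 h2 h3; have := hA' (x_ n).
have := ler_norm (- A'); rewrite normrN; have := normr_ge0 A => h4 h5 H.
have : `|y (x_ n)| < kappa by apply: H; lra.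
lra.
Qed.

End Equation.

(** * The criterion *)

Theorem theorem1p2 (R : realType) (r q : R -> R)
  (r_gt0 : forall x, 0 < r x) (q_gt0 : forall x, 0 < q x)
  (r_cont : continuous r) (q_cont : continuous q)
  (a b alpha beta : R)
  (a_ge1 : 1 <= a) (b_gt0 : 0 < b) (alpha_lt_beta : alpha < beta)
  (slow : forall x : R, x \notin `]alpha, beta[ ->
     forall t : R, `|t - x| <= b * (r x / q x) ->
       (a^-1 <= r t / r x <= a) /\ (a^-1 <= q t / q x <= a))
  (small : a ^+ 2 * expR (- (b / a ^+ 2)) <= 3^-1) :
  [/\ correctly_solvable 1%:E r q <-> 0 < inf (range r) /\ 0 < inf (range q),
      forall p : R, 1 < p ->
        let p' := p / (p - 1) in
        correctly_solvable p%:E r q <->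
          0 < inf [set r x `^ p^-1 * q x `^ p'^-1 | x in [set: R]] /\
          0 < inf (range q) &
      correctly_solvable +oo%E r q <->
        q x @[x --> +oo] --> +oo /\ q x @[x --> -oo] --> +oo].
Proof.
have [|Phi dPhi] := @continuous_antiderivative R (fun x => q x / r x).
  by apply: continuous_div => // x; rewrite gt_eqF.
have finite (p : R) : 1 <= p -> correctly_solvable p%:E r q <->
    0 < inf (range (weight r q p)) /\ 0 < inf (range q).
  move=> p1; split=> [cs|].
    split; apply/(inf_gt0P 0).
    - by move=> x; rewrite mulr_ge0 ?powR_ge0.
    - exact: (weight_lower_necessary r_gt0 q_gt0 r_cont q_cont dPhi
        a_ge1 b_gt0 slow).
    - by move=> x; exact: ltW.
    - exact: (q_lower_necessary r_gt0 q_gt0 r_cont q_cont dPhi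
        a_ge1 b_gt0 slow p1).
  move=> [/(inf_gt0P 0) winf /(inf_gt0P 0) qinf].
  have [|s s0 sle] := winf; first by move=> x; rewrite mulr_ge0 ?powR_ge0.
  have [|k k0 kle] := qinf; first by move=> x; exact: ltW.
  exact: (correctly_solvable_finite_sufficient r_gt0 q_gt0 r_cont q_cont dPhi
    a_ge1 b_gt0 alpha_lt_beta slow small p1 s0 sle k0 kle).
split.
- rewrite (finite 1 (lexx _)) (_ : weight r q 1 = r)//.
  by apply/funext => x; rewrite /weight invr1 subrr powRr0 mulr1 powRr1// ltW.
- move=> p p1 p'; rewrite (finite p (ltW p1))
    (_ : range _ = [set r x `^ p^-1 * q x `^ p'^-1 | x in [set: R]])//.
  congr [set _ | _ in _]; apply/funext => x; rewrite /weight; congr (_ * _ `^ _).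
  by rewrite /p' invf_div; field; rewrite gt_eqF// (lt_trans _ p1).
- split.
    exact: (correctly_solvable_infty_necessary r_gt0 q_gt0 r_cont q_cont dPhi
      a_ge1 b_gt0 slow).
  move=> [qp qn].
  exact: (correctly_solvable_infty_sufficient r_gt0 q_gt0 r_cont q_cont dPhi
    a_ge1 b_gt0 slow).
Qed.
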